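(* Let $r>0$. Every hyperbolic horo-catenary in $\mathbb{H}^2(r)$ with respect to a geodesic $\ell$ is an extrinsic catenary of elliptic type, with respect to the Lorentzian plane $P^2$ such that $\ell=P^2\cap\mathbb{H}^2(r)$. Consequently, the generating curve of any minimal surface of revolution in $\mathbb{H}^3(r)$ of elliptic type is a horo-catenary (with respect to the geodesic $\ell=P^2\cap\mathbb{H}^2(r)$, where $P^2$ is the axis of revolution and $\mathbb{H}^2(r)=P^3\cap \mathbb{H}^3(r)$ is the hyperbolic plane containing the generating curve).
   Context: $\mathbb{E}_1^{n+1}$ is $\mathbb{R}^{n+1}$ with $\langle X,Y\rangle_1=-X_0Y_0+\sum_{i=1}^nX_iY_i$, and $\mathbb{H}^n(r)=\{X\in\mathbb{E}_1^{n+1}:\langle X,X\rangle_1=-r^2,\ X_0>0\}$ with the induced Riemannian metric. $\mathbb{H}^2(r)$ is regarded as $P^3\cap\mathbb{H}^3(r)$ for a 3-dimensional linear subspace $P^3\subset\mathbb{E}_1^4$ meeting $\mathbb{H}^3(r)$ (e.g. $P^3=\{(x,y,z,0)\}$). Every geodesic $\ell$ of $\mathbb{H}^2(r)$ is $P^2\cap\mathbb{H}^2(r)$ for a unique 2-dimensional linear subspace $P^2\subset P^3$ on which $\langle\cdot,\cdot\rangle_1$ is Lorentzian. Horo-catenary: fix a geodesic $\ell$ and one of its two ideal endpoints. For $p\in\mathbb{H}^2(r)$, the horocycle distance $d_h(\ell,p)$ is the length, between $\ell$ and $p$, of the arc of the horocycle centered at the chosen ideal endpoint (hence orthogonal to $\ell$)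 and passing through $p$. A hyperbolic horo-catenary (also ''horocatenary'') with respect to $\ell$ is a smooth regular curve $\gamma$ in $\mathbb{H}^2(r)$, lying on one side of $\ell$ and not meeting $\ell$, that on every compact subinterval $[a,b]$ of its domain is a critical point, among smooth variations with fixed endpoints, of $\int_a^b d_h(\ell,\gamma(t))\,\|\dot\gamma(t)\|\,dt$. Extrinsic catenary of elliptic type with respect to a Lorentzian plane $P^2\subset P^3$: let $\nu\in P^3$ be a unit spacelike vector orthogonal to $P^2$ and let $\mathrm{dist}(p,P^2)=|\langle p,\nu\rangle_1|$. It is a smooth regular curve $\gamma$ in $\mathbb{H}^2(r)=P^3\cap\mathbb{H}^3(r)$, not meeting $P^2$, that on every compact subinterval $[a,b]$ is a critical point, among smooth variations with fixed endpoints, of $\int_a^b\mathrm{dist}(\gamma(t),P^2)\,\|\dot\gamma(t)\|\,dt$. Surface of revolution of elliptic type: given $P^2\subset P^3$ with $P^2$ Lorentzian and a smooth regular curve $\gamma$ in $P^3\cap\mathbb{H}^3(r)$ not intersecting $P^2$, it is the union of the orbits of the points of $\gamma$ under the group of orthogonal transformations of $\mathbb{E}_1^4$ with positive determinant leaving $P^2$ pointwise fixed; $\gamma$ is its generating curve and $P^2$ its axis. Minimal means that the mean curvature in $\mathbb{H}^3(r)$ vanishes identically. *)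

(* Defs.v *)
(* Linear algebra is that of MathComp (row vectors, {vspace _}, \det) over the
   real numbers R of Stdlib, whose field structure comes from Rstruct; calculus
   is that of Coquelicot.  Real-valued expressions are read in R_scope. *)
From mathcomp Require Import all_boot all_order all_algebra.
From mathcomp Require Import Rstruct.
From Stdlib Require Import Reals.
From Coquelicot Require Import Coquelicot.

Set Implicit Arguments.
Unset Strict Implicit.
Unset Printing Implicit Defensive.

Open Scope ring_scope.
Open Scope R_scope.

Definition mink (n : nat) (X Y : 'rV[R]_n.+1) : R :=
  - (X ord0 ord0 * Y ord0 ord0)
  + \sum_(i < n) (X ord0 (lift ord0 i) * Y ord0 (lift ord0 i)).

Definition hyperbolic_space (n : nat) (r : R) (X : 'rV[R]_n.+1) : Prop :=
  mink X X = - r ^ 2 /\ 0 < X ord0 ord0.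

Notation E14 := 'rV[R]_4.

(* The induced form has signature (-,+,...,+): a timelike line of P whose
   orthogonal complement in P is positive definite. *)
Definition lorentzian (P : {vspace E14}) : Prop :=
  exists e : E14, [/\ e \in P, mink e e < 0 &
    forall X : E14, X \in P -> mink X e = 0 -> X <> GRing.zero -> 0 < mink X X].

Definition hyperbolic_plane (r : R) (P3 : {vspace E14}) (X : E14) : Prop :=
  X \in P3 /\ hyperbolic_space r X.

(* P3 cuts a hyperbolic plane H^2(r) out of H^3(r), and P2 cuts a geodesic out
   of that plane. *)
Definition plane_and_geodesic (r : R) (P3 P2 : {vspace E14}) : Prop :=
  [/\ \dim P3 = 3%nat, (exists X, hyperbolic_plane r P3 X),
      \dim P2 = 2%nat, (P2 <= P3)%VS & lorentzian P2].

Definition geodesic (r : R) (P3 P2 : {vspace E14}) (X : E14) : Prop :=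
  X \in P2 /\ hyperbolic_plane r P3 X.

Definition unit_normal_in (P3 P2 : {vspace E14}) (nu : E14) : Prop :=
  [/\ nu \in P3, mink nu nu = 1 & forall X, X \in P2 -> mink X nu = 0].

(* Componentwise calculus.  In smooth and smooth2 the set is meant to be open. *)

Definition velocity (c : R -> E14) (t : R) : E14 :=
  \row_i Derive (fun u => c u ord0 i) t.

Definition speed (c : R -> E14) (t : R) : R :=
  sqrt (mink (velocity c t) (velocity c t)).

Definition smooth (D : R -> Prop) (c : R -> E14) : Prop :=
  forall (i : 'I_4) (k : nat) (t : R),
    D t -> ex_derive_n (fun u => c u ord0 i) k t.

Definition partial1 (F : R -> R -> E14) (u v : R) : E14 :=
  velocity (fun x => F x v) u.

Definition partial2 (F : R -> R -> E14) (u v : R) : E14 :=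
  velocity (F u) v.

Definition smooth2 (D : R -> R -> Prop) (F : R -> R -> E14) : Prop :=
  forall (i : 'I_4) (k : nat) (u v : R),
    D u v -> ex_diff_n (fun x y => F x y ord0 i) k u v.

Definition open_itv (alpha beta : Rbar) (t : R) : Prop :=
  Rbar_lt alpha t /\ Rbar_lt t beta.

Definition regular_curve (r : R) (P3 : {vspace E14}) (alpha beta : Rbar)
    (g : R -> E14) : Prop :=
  [/\ Rbar_lt alpha beta,
      smooth (open_itv alpha beta) g,
      forall t, open_itv alpha beta t -> hyperbolic_plane r P3 (g t) &
      forall t, open_itv alpha beta t -> velocity g t <> GRing.zero].

Definition weighted_length (rho : E14 -> R) (c : R -> E14) (a b : R) : R :=
  RInt (fun t => rho (c t) * speed c t) a b.

Record variation (M : E14 -> Prop) (g : R -> E14) (a b eps : R)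
    (G : R -> R -> E14) : Prop := {
  (* smooth on a neighbourhood of ]-eps, eps[ x [a, b] *)
  variation_smooth : exists delta, 0 < delta /\
    smooth2 (fun s t => -eps < s < eps /\ a - delta < t < b + delta) G;
  variation_in : forall s t, -eps < s < eps -> a <= t <= b -> M (G s t);
  variation_start : forall t, a <= t <= b -> G 0 t = g t;
  variation_left : forall s, -eps < s < eps -> G s a = g a;
  variation_right : forall s, -eps < s < eps -> G s b = g b }.

Definition critical (M : E14 -> Prop) (rho : E14 -> R) (alpha beta : Rbar)
    (g : R -> E14) : Prop :=
  forall a b, a < b -> open_itv alpha beta a -> open_itv alpha beta b ->
  forall eps G, 0 < eps -> variation M g a b eps G ->
  is_derive (fun s => weighted_length rho (G s) a b) 0 0.

(* Ideal points of the hyperboloid model are future null rays; the two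
   endpoints of the geodesic cut by P2 are the two such rays inside P2. *)
Definition ideal_endpoint (P2 : {vspace E14}) (N : E14) : Prop :=
  [/\ N \in P2, mink N N = 0 & 0 < N ord0 ord0].

(* The horocycles centered at the ideal point represented by N are the level
   sets of X |-> mink X N. *)
Definition horocycle (r : R) (P3 : {vspace E14}) (N p X : E14) : Prop :=
  hyperbolic_plane r P3 X /\ mink X N = mink p N.

(* d is the length of an arc of the horocycle through p, parametrized by
   [u, v] from a point of l to p; u = v is allowed, for p on l. *)
Definition horocycle_arc_length (r : R) (P3 : {vspace E14}) (l : E14 -> Prop)
    (N p : E14) (d : R) : Prop :=
  exists (u v : R) (c : R -> E14),
    [/\ u <= v, smooth (fun=> True) c,
        (forall t, u <= t <= v -> horocycle r P3 N p (c t) /\ velocity c t <> GRing.zero),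
        (forall t t', u <= t <= v -> u <= t' <= v -> c t = c t' -> t = t') &
        [/\ l (c u), c v = p & d = RInt (speed c) u v]].

Definition horocycle_dist (r : R) (P3 : {vspace E14}) (l : E14 -> Prop)
    (N p : E14) : R :=
  iota (fun d : R => horocycle_arc_length r P3 l N p d).

(* The two sides of the geodesic are the half-planes mink X nu > 0, for the two
   choices of the unit normal nu. *)
Definition on_one_side (P3 P2 : {vspace E14}) (alpha beta : Rbar)
    (g : R -> E14) : Prop :=
  exists nu, unit_normal_in P3 P2 nu /\
    forall t, open_itv alpha beta t -> 0 < mink (g t) nu.

Definition horo_catenary (r : R) (P3 P2 : {vspace E14}) (N : E14)
    (alpha beta : Rbar) (g : R -> E14) : Prop :=
  [/\ regular_curve r P3 alpha beta g,
      on_one_side P3 P2 alpha beta g,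
      forall t, open_itv alpha beta t -> ~ geodesic r P3 P2 (g t) &
      critical (hyperbolic_plane r P3)
        (horocycle_dist r P3 (geodesic r P3 P2) N) alpha beta g].

Definition elliptic_catenary (r : R) (P3 P2 : {vspace E14})
    (alpha beta : Rbar) (g : R -> E14) : Prop :=
  [/\ regular_curve r P3 alpha beta g,
      forall t, open_itv alpha beta t -> g t \notin P2 &
      exists nu, unit_normal_in P3 P2 nu /\
        critical (hyperbolic_plane r P3) (fun p => Rabs (mink p nu))
          alpha beta g].

(* Matrices act on row vectors from the right. *)
Definition rotation_about (P2 : {vspace E14}) (A : 'M[R]_4) : Prop :=
  [/\ forall X Y : E14, mink (X *m A) (Y *m A) = mink X Y,
      0 < \det A &
      forall X : E14, X \in P2 -> X *m A = X].

Definition surface_of_revolution (P2 : {vspace E14}) (alpha beta : Rbar)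
    (g : R -> E14) (X : E14) : Prop :=
  exists t A, [/\ open_itv alpha beta t, rotation_about P2 A & X = g t *m A].

Definition regular_patch (r : R) (S : E14 -> Prop) (D : R -> R -> Prop)
    (F : R -> R -> E14) : Prop :=
  [/\ forall u v, D u v -> locally_2d D u v,
      smooth2 D F,
      forall u v, D u v -> hyperbolic_space r (F u v) /\ S (F u v) &
      forall u v, D u v -> free [:: partial1 F u v; partial2 F u v]].

(* Unit normal of the patch inside the tangent space of H^3(r), which is the
   orthogonal complement of the position vector. *)
Definition patch_normal (F : R -> R -> E14) (u v : R) (N : E14) : Prop :=
  mink N N = 1 /\
  [/\ mink (F u v) N = 0, mink (partial1 F u v) N = 0 &
      mink (partial2 F u v) N = 0].

(* N being tangent to H^3(r), the coefficients e, f, g of the second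
   fundamental form in H^3(r) are the N-components of the flat second
   derivatives. *)
Definition mean_curvature (F : R -> R -> E14) (u v : R) (N : E14) : R :=
  let E := mink (partial1 F u v) (partial1 F u v) in
  let F' := mink (partial1 F u v) (partial2 F u v) in
  let G := mink (partial2 F u v) (partial2 F u v) in
  let e := mink (partial1 (partial1 F) u v) N in
  let f := mink (partial1 (partial2 F) u v) N in
  let g := mink (partial2 (partial2 F) u v) N in
  (e * G - 2 * f * F' + g * E) / (2 * (E * G - F' ^ 2)).

(* The surface may have self-intersections; it is tested on all its regular
   patches, the sign of the mean curvature depending on the normal. *)
Definition minimal_surface (r : R) (S : E14 -> Prop) : Prop :=
  forall D F, regular_patch r S D F ->
  forall u v N, D u v -> patch_normal F u v N -> mean_curvature F u v N = 0.

(* Main.v *)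
(* The horocycle about the ideal point [N] through [p] is
   s |-> q + s nu - s^2 / (2 c) N, with q on the geodesic, nu the unit normal of
   P2 in P3 and c = <p, N>; it has unit speed, so the horocycle distance from p
   to the geodesic is exactly |<p, nu>|.  Horo-catenaries and extrinsic
   catenaries are therefore critical for the same functional.

   For a surface of revolution F(u, v) = R_v (g u), vanishing mean curvature
   along v = 0 reads <g, nu> <g'', n> = <nu, n> <g', g'> for the unit normal n of
   g in the hyperbolic plane.  This is the Euler-Lagrange equation: for a
   variation field V it makes the derivative of the integrand
   <g, nu> |g'| equal to the derivative of <g, nu> <V, g'> / |g'|, which vanishes
   at both ends. *)
Require Import Defs.
From HB Require Import structures.
From mathcomp Require Import all_boot all_order all_algebra.
From mathcomp Require Import Rstruct.
From Stdlib Require Import Reals.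
From Coquelicot Require Import Coquelicot.
From Stdlib Require Import Lra Ranalysis5.
Open Scope ring_scope.
Open Scope R_scope.

(** * Linear algebra of Minkowski space *)

Local Notation "u +v v" := (GRing.add u v) (at level 50, left associativity).
Local Notation "a *v u" := (GRing.scale a%R u) (at level 40, left associativity).
Local Notation "u -v v" := (GRing.add u (GRing.opp v)) (at level 50, left associativity).

(** The horocycle distance is a definite description over all parametrized arcs, so one explicit arc
    does not determine it: every arc must be shown to have the same length. This rests on the fact
    that, inside the Lorentzian plane [P2], only the multiples of the null vector [N] are orthogonal
    to [N]. A tangent vector of a horocycle is then a multiple of [N] plus a multiple of [nu], and
    the nullity of [N] leaves only the [nu]-component in the speed.

    Since the form is indefinite, independence and normalization are obtained from a timelike vector
    at hand: whatever is orthogonal to it is spacelike. The sheet of the hyperboloid is decided by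
    the sign of the product with [N], which is constant along horocycles and under the rotations.

    In the first variation the absolute value and the square root are not smooth everywhere;
    compactness of [[a, b]] keeps the varied curves where they are. An equation in the normal
    direction [n] alone suffices because a weighted length does not depend on the parametrization,
    so that tangential variations contribute only boundary terms. *)

Lemma minkE (X Y : 'rV[R]_4) :
  mink X Y =
  - (X ord0 ord0 * Y ord0 ord0)
  + X ord0 (lift ord0 ord0) * Y ord0 (lift ord0 ord0)
  + X ord0 (lift ord0 (lift ord0 ord0)) * Y ord0 (lift ord0 (lift ord0 ord0))
  + X ord0 (lift ord0 (lift ord0 (lift ord0 ord0)))
    * Y ord0 (lift ord0 (lift ord0 (lift ord0 ord0))).
Proof.
rewrite /mink !big_ord_recl big_ord0 GRing.addr0 -!(RplusE, RmultE); lra.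
Qed.

Lemma minkC (X Y : 'rV[R]_4) : mink X Y = mink Y X.
Proof. rewrite !minkE; ring. Qed.

Lemma rvD (X Y : 'rV[R]_4) i : (X +v Y) ord0 i = X ord0 i + Y ord0 i.
Proof. by rewrite mxE. Qed.

Lemma rvZ a (X : 'rV[R]_4) i : (a *v X) ord0 i = a * X ord0 i.
Proof. by rewrite mxE. Qed.

Lemma rvN (X : 'rV[R]_4) i : (GRing.opp X) ord0 i = - X ord0 i.
Proof. by rewrite mxE. Qed.

Lemma rv0 i : (GRing.zero : 'rV[R]_4) ord0 i = 0.
Proof. by rewrite mxE. Qed.

Lemma rv_ext (X Y : 'rV[R]_4) : (forall i, X ord0 i = Y ord0 i) -> X = Y.
Proof. by move=> XY; apply/rowP => i; apply: XY. Qed.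

Definition rvE := (rvD, rvZ, rvN, rv0).

Lemma minkDl (X Y Z : 'rV[R]_4) : mink (X +v Y) Z = mink X Z + mink Y Z.
Proof. rewrite !minkE !rvE; ring. Qed.

Lemma minkZl a (X Z : 'rV[R]_4) : mink (a *v X) Z = a * mink X Z.
Proof. rewrite !minkE !rvE; ring. Qed.

Lemma minkNl (X Z : 'rV[R]_4) : mink (GRing.opp X) Z = - mink X Z.
Proof. rewrite !minkE !rvE; ring. Qed.

Lemma mink0l (Z : 'rV[R]_4) : mink (GRing.zero : 'rV[R]_4) Z = 0.
Proof. rewrite !minkE !rvE; ring. Qed.

Lemma minkDr (X Y Z : 'rV[R]_4) : mink Z (X +v Y) = mink Z X + mink Z Y.
Proof. by rewrite minkC minkDl !(minkC _ Z). Qed.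

Lemma minkZr a (X Z : 'rV[R]_4) : mink Z (a *v X) = a * mink Z X.
Proof. by rewrite minkC minkZl minkC. Qed.

Lemma minkNr (X Z : 'rV[R]_4) : mink Z (GRing.opp X) = - mink Z X.
Proof. by rewrite minkC minkNl minkC. Qed.

Lemma mink0r (Z : 'rV[R]_4) : mink Z (GRing.zero : 'rV[R]_4) = 0.
Proof. by rewrite minkC mink0l. Qed.

Definition mink_lin := (minkDl, minkDr, minkZl, minkZr, minkNl, minkNr, mink0l, mink0r).

(** Orthogonality makes [x0 * e0] the Euclidean product of the spatial parts. As the spatial part of
    [e] is shorter than its time coordinate, Cauchy-Schwarz forces every coordinate of [X] to vanish
    when [mink X X] is not positive. *)
Lemma timelike_orthogonal (e X : 'rV[R]_4) :
  mink e e < 0 -> mink X e = 0 -> X <> GRing.zero -> 0 < mink X X.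
Proof.
move=> ee Xe X0; apply: Rnot_le_lt => XX; apply: X0.
move: ee Xe XX; rewrite !minkE.
set e0 := e _ _; set e1 := e _ _; set e2 := e _ _; set e3 := e _ _.
set x0 := X _ _; set x1 := X _ _; set x2 := X _ _; set x3 := X _ _.
move=> ee Xe XX.
have cs : (x0 * e0) ^ 2 <= (x1 ^ 2 + x2 ^ 2 + x3 ^ 2) * (e1 ^ 2 + e2 ^ 2 + e3 ^ 2).
  have -> : x0 * e0 = x1 * e1 + x2 * e2 + x3 * e3 by lra.
  have := pow2_ge_0 (x1 * e2 - x2 * e1); have := pow2_ge_0 (x1 * e3 - x3 * e1).
  have := pow2_ge_0 (x2 * e3 - x3 * e2); nra.
have s0 : x1 ^ 2 + x2 ^ 2 + x3 ^ 2 <= 0.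
  apply: Rnot_lt_le => s0; nra.
have x10 : x1 = 0 by nra.
have x20 : x2 = 0 by nra.
have x30 : x3 = 0 by nra.
have x00 : x0 = 0.
  have : x0 * e0 = 0 by rewrite x10 x20 x30 in Xe; lra.
  case/Rmult_integral => // e00; rewrite e00 in ee; nra.
apply/rowP => i; rewrite rv0.
case: (unliftP ord0 i) => [j ->|-> //].
case: (unliftP ord0 j) => [k ->|-> //].
case: (unliftP ord0 k) => [l ->|-> //].
by rewrite (ord1 l).
Qed.

Lemma future_mink_lt0 (p N : 'rV[R]_4) :
  mink p p < 0 -> 0 < p ord0 ord0 -> mink N N <= 0 -> 0 < N ord0 ord0 ->
  mink p N < 0.
Proof.
rewrite !minkE.
set e0 := p _ _; set e1 := p _ _; set e2 := p _ _; set e3 := p _ _.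
set x0 := N _ _; set x1 := N _ _; set x2 := N _ _; set x3 := N _ _.
move=> pp p0 NN N0; apply: Rnot_le_lt => le0.
have cs : (x0 * e0) ^ 2 <= (x1 ^ 2 + x2 ^ 2 + x3 ^ 2) * (e1 ^ 2 + e2 ^ 2 + e3 ^ 2).
  apply: (Rle_trans _ ((x1 * e1 + x2 * e2 + x3 * e3) ^ 2)).
    by apply: pow_incr; nra.
  have := pow2_ge_0 (x1 * e2 - x2 * e1); have := pow2_ge_0 (x1 * e3 - x3 * e1).
  have := pow2_ge_0 (x2 * e3 - x3 * e2); nra.
have : (x1 ^ 2 + x2 ^ 2 + x3 ^ 2) * (e1 ^ 2 + e2 ^ 2 + e3 ^ 2)
    <= x0 ^ 2 * (e1 ^ 2 + e2 ^ 2 + e3 ^ 2).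
  by apply: Rmult_le_compat_r; nra.
have : x0 ^ 2 * (e1 ^ 2 + e2 ^ 2 + e3 ^ 2) < x0 ^ 2 * e0 ^ 2.
  by apply: Rmult_lt_compat_l; nra.
nra.
Qed.

(** Otherwise [- p] would be future, and the preceding lemma would give the wrong sign. This is how
    points built later are placed on the upper sheet without estimating their time coordinate. *)
Lemma mink_lt0_future (p N : 'rV[R]_4) :
  mink p p < 0 -> mink N N <= 0 -> 0 < N ord0 ord0 -> mink p N < 0 ->
  0 < p ord0 ord0.
Proof.
move=> pp NN N0 pN; apply: Rnot_le_lt => p0.
have p0' : p ord0 ord0 <> 0.
  by move=> e; move: pp; rewrite minkE e; nra.
have : mink (GRing.opp p) N < 0.
  by apply: future_mink_lt0 => //; rewrite ?minkNl ?minkNr ?rvE; lra.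
rewrite minkNl; lra.
Qed.

(** A vector in the span of the others would be orthogonal to itself. For an indefinite form this
    contradicts nothing unless null vectors are excluded, hence the first hypothesis. *)
Lemma free_orthogonal (s : seq 'rV[R]_4) :
  (forall x, x \in s -> mink x x <> 0) ->
  pairwise (fun x y => mink x y == 0) s -> free s.
Proof.
elim: s => [|x s IH] nz; first by rewrite nil_free.
rewrite pairwise_cons => /andP[/allP xs ps]; rewrite free_cons IH //; last first.
  by move=> y ys; apply: nz; rewrite inE ys orbT.
rewrite andbT; apply/negP => xsp; apply: (nz x); first by rewrite inE eqxx.
rewrite {2}(coord_span (X := in_tuple s) xsp).
apply: (big_ind (fun y => mink x y = 0)) => [|y z xy xz|i _].
- by rewrite mink0r.
- by rewrite minkDr xy xz; lra.
- rewrite minkZr; have /eqP -> := xs _ (mem_nth GRing.zero (ltn_ord i)); ring.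
Qed.

(** Rank-nullity for the map that records the products with the members of [s]: its kernel meets [P]
    in positive dimension. *)
Lemma exists_orthogonal (P : {vspace 'rV[R]_4}) (s : seq 'rV[R]_4) :
  (size s < \dim P)%nat ->
  exists2 n, n \in P /\ n <> GRing.zero & forall x, x \in s -> mink n x = 0.
Proof.
move=> sP.
pose f (n : 'rV[R]_4) : 'rV[R]_(size s) := \row_i mink n (nth GRing.zero s i).
have lf : GRing.linear_for *:%R f.
  by move=> a u v; apply/rowP => i; rewrite !mxE minkDl minkZl.
pose lfun := GRing.isLinear.Build R 'rV[R]_4 'rV[R]_(size s) *:%R f lf.
pose F : {linear 'rV[R]_4 -> 'rV[R]_(size s)} := HB.pack f lfun.
have := limg_ker_dim (linfun F) P.
have lim : (\dim (linfun F @: P) <= size s)%nat.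
  by apply: leq_trans (dimvS (subvf _)) _; rewrite dimvf /dim /= mul1n.
move=> dims.
have : (0 < \dim (P :&: lker (linfun F)))%nat.
  rewrite lt0n; apply/eqP => d0; move: dims; rewrite d0 add0n => d1.
  by move: sP; rewrite -d1 ltnNge lim.
rewrite lt0n dimv_eq0 => k0.
have := memv_pick (P :&: lker (linfun F))%VS.
rewrite memv_cap => /andP[nP]; rewrite memv_ker lfunE /= => /eqP fn.
exists (vpick (P :&: lker (linfun F))%VS); first by split=> //; apply/eqP; rewrite vpick0.
move=> x xs; have xi : (index x s < size s)%nat by rewrite index_mem.
by move: fn => /rowP /(_ (Ordinal xi)); rewrite !mxE /= nth_index.
Qed.

(** A nonzero [X] would be spacelike and would extend [e :: s] to an orthogonal, hence free, family
    too large for [P]. The lemma serves to prove that a vector equals its orthogonal expansion, by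
    testing the difference. *)
Lemma orthogonal_complete (P : {vspace 'rV[R]_4}) (e : 'rV[R]_4) (s : seq 'rV[R]_4)
    (X : 'rV[R]_4) :
  \dim P = (size s).+1 -> mink e e < 0 -> {subset e :: s <= P} ->
  (forall y, y \in s -> mink y e = 0 /\ y <> GRing.zero) ->
  pairwise (fun x y => mink x y == 0) s ->
  X \in P -> (forall y, y \in e :: s -> mink X y = 0) -> X = GRing.zero.
Proof.
move=> dP ee sP se ps XP Xs.
case: (X =P GRing.zero) => // X0.
have Xe : mink X e = 0 by apply: Xs; rewrite inE eqxx.
have Xsp : 0 < mink X X by apply: (timelike_orthogonal e).
have fr : free [:: X, e & s].
  apply: free_orthogonal => [y|].
    rewrite !inE => /or3P[/eqP ->|/eqP ->|ys]; try lra.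
    have [ye y0] := se _ ys; have := timelike_orthogonal e y ee ye y0; lra.
  rewrite /= ps andbT Xe eqxx /=; apply/andP; split.
    by apply/allP => y ys; apply/eqP; apply: Xs; rewrite inE ys orbT.
  by apply/allP => y ys; apply/eqP; rewrite minkC; case: (se _ ys).
have : (size [:: X, e & s] <= \dim P)%nat.
  rewrite -(eqP fr); apply: dimvS; apply/span_subvP => y.
  by rewrite inE => /orP[/eqP -> //|]; apply: sP.
by rewrite dP /= ltnn.
Qed.

Lemma unit_multiple (n : 'rV[R]_4) : 0 < mink n n ->
  mink (/ sqrt (mink n n) *v n) (/ sqrt (mink n n) *v n) = 1.
Proof.
move=> nn; rewrite !mink_lin -{3}(sqrt_sqrt (mink n n)); last lra.
have := sqrt_lt_R0 _ nn; move=> ?; field; lra.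
Qed.

Lemma exists_unit_orthogonal (P Q : {vspace 'rV[R]_4}) (e : 'rV[R]_4) :
  e \in Q -> mink e e < 0 -> (\dim Q < \dim P)%nat ->
  exists n, [/\ n \in P, mink n n = 1 & forall X, X \in Q -> mink X n = 0].
Proof.
move=> eQ ee QP.
have sz : (size (vbasis Q) < \dim P)%nat by rewrite size_tuple.
have [n [nP n0] ns] := exists_orthogonal P (vbasis Q) sz.
have nQ X : X \in Q -> mink X n = 0.
  move=> XQ; rewrite (coord_vbasis XQ).
  apply: (big_ind (fun y => mink y n = 0)) => [|y z yn zn|i _].
  - by rewrite mink0l.
  - by rewrite minkDl yn zn; lra.
  - rewrite minkZl minkC ns; first exact: Rmult_0_r.
    by rewrite mem_nth // size_tuple.
have nn : 0 < mink n n by apply: (timelike_orthogonal e) => //; rewrite minkC nQ.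
exists (/ sqrt (mink n n) *v n); split; first exact: memvZ.
  exact: unit_multiple.
by move=> X XQ; rewrite minkZr (nQ X) //; ring.
Qed.

(** [Q] is the direct sum of [P] and the line of [n], and the product with [n] reads off the
    component along that line. *)
Lemma orthogonal_mem (P Q : {vspace 'rV[R]_4}) (n X : 'rV[R]_4) :
  (P <= Q)%VS -> \dim Q = (\dim P).+1 ->
  n \in Q -> mink n n = 1 -> (forall Y, Y \in P -> mink Y n = 0) ->
  X \in Q -> mink X n = 0 -> X \in P.
Proof.
move=> PQ dQ nQ nn nP XQ Xn.
have n0 : n != GRing.zero by apply/eqP => n0; move: nn; rewrite n0 mink0l; lra.
have PnI : (P :&: <[n]>)%VS = 0%VS.
  apply/eqP; rewrite -subv0; apply/subvP => Y; rewrite memv_cap => /andP[YP].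
  move=> /vlineP[a Ya]; have := nP _ YP; rewrite Ya minkZl nn => a0.
  by rewrite (_ : a = 0) ?GRing.scale0r ?mem0v //; lra.
have PnQ : (P + <[n]>)%VS == Q.
  rewrite eqEdim subv_add PQ -memvE nQ /= dimv_disjoint_sum // dim_vline n0 dQ.
  by rewrite addn1.
move: XQ; rewrite -(eqP PnQ) => /memv_addP[Y YP [Z /vlineP[a ->]]] XE.
move: Xn; rewrite XE minkDl minkZl nP // nn => a0.
by rewrite (_ : a = 0) ?GRing.scale0r ?GRing.addr0 //; lra.
Qed.

(** * The null direction of a Lorentzian plane *)

Section Configuration.

Variables (r : R) (P3 P2 : {vspace 'rV[R]_4}).
Hypothesis (r_gt0 : 0 < r) (conf : plane_and_geodesic r P3 P2).

Lemma exists_unit_normal : exists nu, unit_normal_in P3 P2 nu.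
Proof.
case: conf => d3 _ d2 _ [e [eP2 ee _]].
by apply: (exists_unit_orthogonal P3 P2 e) => //; rewrite d2 d3.
Qed.

Variable N : 'rV[R]_4.
Hypothesis endpt : ideal_endpoint P2 N.

Lemma mink_endpoint_lt0 p : hyperbolic_space r p -> mink p N < 0.
Proof.
case: endpt => _ NN N0 [pp p0]; apply: future_mink_lt0 => //; nra.
Qed.

(** The combination [mink N e *v U -v (mink U e *v N)] is orthogonal to [e] by its coefficients and
    to [N] because both [U] and [N] are. It is therefore orthogonal to a whole basis of [P2], and
    vanishes. *)
Lemma endpoint_orthogonal U : U \in P2 -> mink U N = 0 -> exists a, U = a *v N.
Proof.
case: conf => d3 _ d2 _ [e [eP2 ee _]]; case: endpt => NP NN N0 UP UN.
have Nn0 : N <> GRing.zero by move=> n0; move: N0; rewrite n0 rv0; lra.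
have Ne : mink N e <> 0.
  move=> Ne; have := timelike_orthogonal e N ee Ne Nn0; lra.
have Ne2 : 0 < mink N e ^ 2 by apply: pow2_gt_0.
(* Gram-Schmidt: [e] and [N'] form an orthogonal basis of [P2]. Nullity of [N] gives [N'] the square
   [mink N e ^ 2 / (- mink e e)], which is positive. *)
set N' := N -v ((mink N e / mink e e) *v e).
have N'e : mink N' e = 0 by rewrite /N' !mink_lin; field; lra.
have N'N' : 0 < mink N' N'.
  rewrite /N' !mink_lin NN (minkC e N).
  rewrite [X in _ < X](_ : _ = mink N e ^ 2 / (- mink e e)); last by field; lra.
  by apply: Rdiv_lt_0_compat => //; lra.
have U'0 : mink N e *v U -v (mink U e *v N) = GRing.zero.
  apply: (orthogonal_complete P2 e [:: N']) => //.
  - move=> y; rewrite !inE => /orP[] /eqP -> //.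
    by apply: memvB => //; apply: memvZ.
  - move=> y; rewrite !inE => /eqP ->; split=> // n0; move: N'N'; rewrite n0 mink0l; lra.
  - by apply: memvB => //; apply: memvZ.
  - move=> y; rewrite !inE => /orP[] /eqP ->; rewrite /N' !mink_lin; first ring.
    rewrite UN NN; field; lra.
exists (mink U e / mink N e); apply/rowP => i.
have h : mink N e * U ord0 i + - (mink U e * N ord0 i) = 0.
  by rewrite -(rv0 i) -U'0 !rvE.
rewrite rvZ; apply: (Rmult_eq_reg_l (mink N e) (U ord0 i)) => //.
by transitivity (mink U e * N ord0 i); [lra | field].
Qed.

End Configuration.

(** * Curves *)

Lemma nonvanishing_same_sign (f : R -> R) (x y : R) :
  x <= y -> (forall t, x <= t <= y -> continuous f t) ->
  (forall t, x <= t <= y -> f t <> 0) -> 0 < f x * f y.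
Proof.
move=> xy cf f0; case: (Rle_lt_or_eq_dec _ _ xy) => [xy'|e]; last first.
  by subst y; have := f0 x (conj xy xy); nra.
apply: Rnot_le_lt => le0.
have fx := f0 x (conj (Rle_refl x) xy); have fy := f0 y (conj xy (Rle_refl y)).
have cf' t : x <= t <= y -> continuity_pt f t.
  by move=> /cf; apply: (proj2 (continuity_pt_filterlim f t)).
case: (Rlt_le_dec (f x) 0) => fx0.
  have fy0 : 0 < f y by nra.
  by have [z [/f0]] := IVT_interv f x y cf' xy' fx0 fy0.
have fx1 : - f x < 0 by lra.
have fy1 : 0 < - f y by nra.
have [z [/f0 fz]] := IVT_interv (fun t => - f t) x y
  (fun t h => continuity_pt_opp f t (cf' t h)) xy' fx1 fy1.
move=> /= ?; lra.
Qed.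

(** A derivative without interior zeros keeps its sign, so the absolute value leaves the integral.
    Endpoints are exempt because arc conditions hold on a full neighbourhood, and can be
    differentiated, only at interior parameters. *)
Lemma RInt_Rabs_Derive (f : R -> R) (u v : R) :
  u <= v -> (forall t, u <= t <= v -> ex_derive f t) ->
  (forall t, u <= t <= v -> continuous (Derive f) t) ->
  (forall t, u < t < v -> Derive f t <> 0) ->
  RInt (fun t => Rabs (Derive f t)) u v = Rabs (f v - f u).
Proof.
move=> uv df cf f0; case: (Rle_lt_or_eq_dec _ _ uv) => [uv'|e]; last first.
  subst v; rewrite RInt_point /zero /= Rminus_diag Rabs_R0 //.
have uvm : Rmin u v = u /\ Rmax u v = v by rewrite Rmin_left // Rmax_right.
(* Nonnegativity of the integral later gives the sign of [f v - f u], in place of a monotonicity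
   argument. *)
have abs0 : 0 <= RInt (fun t => Rabs (Derive f t)) u v.
  apply: RInt_ge_0 => // [|t _]; last exact: Rabs_pos.
  apply: ex_RInt_continuous; rewrite uvm.1 uvm.2 => t /cf ct.
  by apply: continuous_comp => //; apply: continuous_Rabs.
have RD : RInt (Derive f) u v = f v - f u.
  by apply: RInt_Derive; rewrite uvm.1 uvm.2.
pose m := (u + v) / 2.
have mI : u < m < v by rewrite /m; lra.
have sg t : u < t < v -> 0 < Derive f t * Derive f m.
  move=> tI; case: (Rle_lt_dec t m) => tm.
    by apply: nonvanishing_same_sign => // s sI; [apply: cf|apply: f0]; lra.
  rewrite Rmult_comm.
  by apply: nonvanishing_same_sign => [|s sI|s sI]; [lra|apply: cf|apply: f0]; lra.
case: (Rlt_le_dec (Derive f m) 0) => m0.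
  have E : RInt (fun t => Rabs (Derive f t)) u v = - (f v - f u).
    rewrite -RD -[RHS]/(opp (RInt (Derive f) u v)) -RInt_opp.
      apply: RInt_ext; rewrite uvm.1 uvm.2 => t /sg st.
      rewrite Rabs_left /opp //=; nra.
    by apply: ex_RInt_continuous; rewrite uvm.1 uvm.2.
  rewrite E Rabs_left1; lra.
have E : RInt (fun t => Rabs (Derive f t)) u v = f v - f u.
  rewrite -RD; apply: RInt_ext; rewrite uvm.1 uvm.2 => t /sg st.
  rewrite Rabs_pos_eq //; nra.
rewrite E Rabs_pos_eq; lra.
Qed.

Lemma Derive_n_SE (f : R -> R) k t : Derive_n f k.+1 t = Derive_n (Derive f) k t.
Proof. by rewrite -[Derive f]/(Derive_n f 1) Derive_n_comp -plus_n_Sm -plus_n_O. Qed.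

Lemma ex_derive_n_Derive (f : R -> R) k t :
  ex_derive_n f k.+1 t -> ex_derive_n (Derive f) k t.
Proof.
case: k => [|k] //= df; apply: ex_derive_ext df => u; exact: Derive_n_SE.
Qed.

Lemma ex_derive_n_step (f f' : R -> R) k t :
  locally t (fun u => is_derive f u (f' u)) -> ex_derive_n f' k t ->
  ex_derive_n f k.+1 t.
Proof.
case: k => [|k] df; first by exists (f' t); apply: locally_singleton df.
apply: ex_derive_ext_loc; apply: filter_imp (locally_locally _ _ df) => u df'.
rewrite -/(Derive_n f k.+1 u) Derive_n_SE; apply: Derive_n_ext_loc.
by apply: filter_imp df' => x /is_derive_unique ->.
Qed.

Lemma is_derive_local_const (f : R -> R) t l k :
  is_derive f t l -> locally t (fun u => f u = k) -> l = 0.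
Proof.
move=> df fk; rewrite -(is_derive_unique _ _ _ df).
rewrite -(Derive_const k t); exact: Derive_ext_loc.
Qed.

Lemma is_derive_Rmult (f g : R -> R) t f' g' :
  is_derive f t f' -> is_derive g t g' ->
  is_derive (fun u => f u * g u) t (f' * g t + f t * g').
Proof.
move=> df dg; auto_derive; first by repeat split; eexists; eassumption.
rewrite (is_derive_unique _ _ _ df) (is_derive_unique _ _ _ dg); ring.
Qed.

(** [velocity] is built on the total function [Derive] and says nothing about differentiability;
    this relation also asserts that the derivative exists. *)
Definition is_vderive (c : R -> 'rV[R]_4) t (v : 'rV[R]_4) : Prop :=
  forall i, is_derive (fun u => c u ord0 i) t (v ord0 i).

Lemma velocityE c t i : velocity c t ord0 i = Derive (fun u => c u ord0 i) t.
Proof. by rewrite mxE. Qed.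

Lemma is_vderive_velocity c t v : is_vderive c t v -> velocity c t = v.
Proof.
by move=> cv; apply/rowP => i; rewrite mxE; apply: is_derive_unique.
Qed.

Lemma smooth_velocity_correct D c t :
  smooth D c -> D t -> is_vderive c t (velocity c t).
Proof.
by move=> sc Dt i; rewrite velocityE; apply: Derive_correct (sc i 1%nat t Dt).
Qed.

Lemma smooth_velocity D c : smooth D c -> smooth D (velocity c).
Proof.
move=> sc i k t Dt; apply: (ex_derive_n_ext (Derive (fun u => c u ord0 i))).
  by move=> u; rewrite velocityE.
exact: (ex_derive_n_Derive _ _ _ (sc i k.+1 t Dt)).
Qed.

Lemma is_vderive_const (X : 'rV[R]_4) t : is_vderive (fun=> X) t GRing.zero.
Proof. move=> i; rewrite rv0; exact: is_derive_const. Qed.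

Lemma is_vderive_ext_loc c d t v :
  locally t (fun u => c u = d u) -> is_vderive c t v -> is_vderive d t v.
Proof.
by move=> cd cv i; apply: is_derive_ext_loc (cv i); apply: filter_imp cd => u ->.
Qed.

Lemma is_derive_mink c d t v w :
  is_vderive c t v -> is_vderive d t w ->
  is_derive (fun u => mink (c u) (d u)) t (mink v (d t) + mink (c t) w).
Proof.
move=> cv dw; apply: (is_derive_ext _ _ _ _ (fun u => esym (minkE (c u) (d u)))).
rewrite !minkE.
pose i1 : 'I_4 := lift ord0 ord0; pose i2 : 'I_4 := lift ord0 (lift ord0 ord0).
pose i3 : 'I_4 := lift ord0 (lift ord0 (lift ord0 ord0)).
have dp i := is_derive_Rmult _ _ _ _ _ (cv i) (dw i).
have := is_derive_plus _ _ _ _ _ (is_derive_plus _ _ _ _ _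
  (is_derive_plus _ _ _ _ _ (is_derive_opp _ _ _ (dp ord0)) (dp i1)) (dp i2)) (dp i3).
move=> d4; evar_last; first exact: d4.
rewrite /plus /opp /= /i1 /i2 /i3; ring.
Qed.

Lemma is_derive_minkl c t v (X : 'rV[R]_4) :
  is_vderive c t v -> is_derive (fun u => mink (c u) X) t (mink v X).
Proof.
move=> cv; rewrite -[mink v X]Rplus_0_r -(mink0r (c t)).
exact: (is_derive_mink c (fun=> X)) (is_vderive_const X t).
Qed.

Lemma is_derive_quadratic a b k t :
  is_derive (fun u => a + u * b + k * u ^ 2) t (b + t * (2 * k)).
Proof. by auto_derive => //; ring. Qed.

(** Differentiation stays within this family, with a zero quadratic coefficient, so the induction
    closes. The coordinates of the explicit horocycle have this form. *)
Lemma ex_derive_n_quadratic a b k m t :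
  ex_derive_n (fun u => a + u * b + k * u ^ 2 ) m t.
Proof.
elim: m a b k t => [|m IH] a b k t //.
apply: (ex_derive_n_step _ (fun u => b + u * (2 * k) + 0 * u ^ 2)) (IH _ _ _ t).
apply: filter_forall => u; evar_last; first exact: is_derive_quadratic.
by rewrite /=; ring.
Qed.

(** * Horocycle distance *)

Section HorocycleDistance.

Variables (r : R) (P3 P2 : {vspace 'rV[R]_4}) (N nu : 'rV[R]_4).
Hypothesis (r_gt0 : 0 < r) (conf : plane_and_geodesic r P3 P2).
Hypothesis (endpt : ideal_endpoint P2 N) (nuP : unit_normal_in P3 P2 nu).

(** Turns membership in [P3] into a scalar equation, which can be differentiated along a curve. The
    same [w] later spans, with [nu], the plane of rotation. *)
Lemma exists_ambient_normal :
  exists w, mink w w = 1 /\ forall X, (X \in P3) = (mink X w == 0).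
Proof.
case: conf => d3 _ d2 /subvP s23 [e [eP2 ee _]].
have [|w [wP ww w3]] := exists_unit_orthogonal fullv P3 e (s23 _ eP2) ee.
  by rewrite d3 dimvf /dim.
exists w; split=> // X; apply/idP/eqP => [/w3 //|Xw].
apply: (orthogonal_mem P3 fullv w) => //; rewrite ?subvf ?memvf //.
by rewrite d3 dimvf /dim.
Qed.

Lemma normal_orthogonal X : X \in P3 -> mink X nu = 0 -> X \in P2.
Proof.
case: conf => d3 _ d2 s23 _; case: nuP => nP nn nP2.
by apply: orthogonal_mem => //; rewrite d3 d2.
Qed.

Lemma velocity_mem c t v :
  is_vderive c t v ->
  locally t (fun u => c u \in P3) -> v \in P3.
Proof.
move=> cv cP; have [w [_ wP]] := exists_ambient_normal; rewrite wP; apply/eqP.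
apply: (is_derive_local_const _ _ _ 0 (is_derive_minkl _ _ _ w cv)).
by apply: filter_imp cP => u; rewrite wP => /eqP.
Qed.

Let endpoint_normal : mink N nu = 0.
Proof. by case: endpt nuP => NP _ _ [_ _ nP]; apply: nP. Qed.

(** Differentiating the constraints puts [v] in [P3], orthogonal to [N] and to [c t]. Then
    [v -v (mink v nu *v nu)] lies in [P2] and is orthogonal to [N], so it is some [a *v N], of no
    length. If [mink v nu] were zero, [v = a *v N] would be orthogonal to [c t], whose product with
    [N] is negative; hence [a = 0], against [v <> 0]. *)
Lemma horocycle_speed c p t v :
  is_vderive c t v -> v <> GRing.zero ->
  locally t (fun u => horocycle r P3 N p (c u)) ->
  mink v v = mink v nu ^ 2 /\ mink v nu <> 0.
Proof.
move=> cv v0 hc; have [[cP [cc ct]] cN] := locally_singleton _ _ hc.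
have vP : v \in P3.
  apply: (velocity_mem c t) => //; apply: filter_imp hc => u [[]] //.
have vN : mink v N = 0.
  apply: (is_derive_local_const _ _ _ (mink p N) (is_derive_minkl _ _ _ N cv)).
  by apply: filter_imp hc => u [].
have cv0 : mink (c t) v = 0.
  have := is_derive_local_const _ _ _ (- r ^ 2) (is_derive_mink _ _ _ _ _ cv cv).
  rewrite (minkC v) => h; suff: mink (c t) v + mink (c t) v = 0 by lra.
  by apply: h; apply: filter_imp hc => u [[_ []]].
have cN0 : mink (c t) N < 0 by apply: (mink_endpoint_lt0 r P2).
case: nuP => nP nn nP2.
have [||a Ua] := endpoint_orthogonal r P3 P2 conf N endpt (v -v (mink v nu *v nu)).
- apply: normal_orthogonal; first by apply: memvB => //; apply: memvZ.
  by rewrite !mink_lin nn; ring.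
- by rewrite !mink_lin vN (minkC nu) endpoint_normal; ring.
have vE : v = a *v N +v (mink v nu *v nu) by rewrite -Ua GRing.subrK.
case: endpt => NP NN N0.
split.
  rewrite {1 2}vE !mink_lin NN nn (minkC nu) endpoint_normal; ring.
move=> vn; move: vE; rewrite vn GRing.scale0r GRing.addr0 => vE.
move: cv0; rewrite vE minkZr => /Rmult_integral[a0|]; last lra.
by apply: v0; rewrite vE a0 GRing.scale0r.
Qed.

(** Uniqueness half of the description: on any arc the speed is the absolute derivative of
    [s t = mink (c t) nu], which starts from zero on the geodesic and is monotone. *)
Lemma horocycle_arc_lengthE p d :
  horocycle_arc_length r P3 (geodesic r P3 P2) N p d -> d = Rabs (mink p nu).
Proof.
move=> [u [v [c [uv sc hc _ [lu cv ->]]]]].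
have dc t := smooth_velocity_correct _ _ t sc I.
pose s t := mink (c t) nu.
have ds t : is_derive s t (mink (velocity c t) nu) by apply: is_derive_minkl.
have Ds t : Derive s t = mink (velocity c t) nu by apply: is_derive_unique.
have su : s u = 0 by case: nuP => _ _ nP; apply: nP; case: lu.
have -> : RInt (speed c) u v = RInt (fun t => Rabs (Derive s t)) u v.
  apply: RInt_ext; rewrite Rmin_left // Rmax_right // => t tI.
  have [[_ v0] lt] : (horocycle r P3 N p (c t) /\ velocity c t <> GRing.zero)
      /\ locally t (fun t => horocycle r P3 N p (c t)).
    split; first by apply: hc; lra.
    apply: (locally_interval _ t u v) => /=; [lra|lra|move=> y yu yv].
    by apply (hc y); lra.
  have [vv vn] := horocycle_speed _ _ _ _ (dc t) v0 lt.
  by rewrite /speed vv Ds -Rsqr_pow2 sqrt_Rsqr_abs.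
rewrite RInt_Rabs_Derive // ?su ?Rminus_0_r /s ?cv // => t tI.
- by exists (mink (velocity c t) nu).
- apply: (continuous_ext (fun t => mink (velocity c t) nu)) => [x|]; first by rewrite Ds.
  apply: ex_derive_continuous; eexists; apply: is_derive_minkl.
  exact: (smooth_velocity_correct _ _ _ (smooth_velocity _ _ sc) I).
- rewrite Ds.
  have lt : locally t (fun t => horocycle r P3 N p (c t)).
    apply: (locally_interval _ t u v) => /=; [lra|lra|move=> y yu yv].
    by apply (hc y); lra.
  have [|_ v0] := hc t; first lra.
  by have [] := horocycle_speed _ _ _ _ (dc t) v0 lt.
Qed.

Lemma exists_horocycle_arc p : hyperbolic_plane r P3 p ->
  horocycle_arc_length r P3 (geodesic r P3 P2) N p (Rabs (mink p nu)).
Proof.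
move=> [pP hp]; have := mink_endpoint_lt0 r P2 r_gt0 N endpt p hp.
case: conf => _ _ _ /subvP s23 _; case: hp => pp p0.
case: (endpt) => NP NN N0; case: (nuP) => nP nn nP2.
set b := mink p N => b0.
pose s := mink p nu.
(* [q] is the foot of the arc on the geodesic. Removing [s *v nu] changes the square of [p] by
   [- s ^ 2], and adding [k *v N] changes it by [2 * k * b]; so [k] has to be [s ^ 2 / (2 * b)]. *)
pose q := p -v (s *v nu) +v ((s ^ 2 / (2 * b)) *v N).
(* [eps] is the sign of [s]: the arc is run from 0 up to [Rabs s], hence along [- nu] when [p] is on
   the negative side. *)
have [eps [eps2 epss]] : exists eps, eps ^ 2 = 1 /\ Rabs s * eps = s.
  case: (Rle_lt_dec 0 s) => s0; [exists 1|exists (-1)].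
    by rewrite Rabs_pos_eq //; split; ring.
  by rewrite Rabs_left //; split; ring.
have qE : q +v (s *v nu) +v (- (s ^ 2 / (2 * b)) *v N) = p.
  by apply: rv_ext => i; rewrite /q !rvE; ring.
pose c t := q +v (t * eps *v nu) +v (- / (2 * b) * t ^ 2 *v N).
have Nnu : mink nu N = 0 by rewrite minkC endpoint_normal.
have qP : q \in P3 by apply: memvD; [apply: memvB => //|]; apply: memvZ => //; apply: s23.
have qN : mink q N = b by rewrite /q !mink_lin NN Nnu /b; ring.
have qn : mink q nu = 0 by rewrite /q !mink_lin nn endpoint_normal /s; ring.
have qq : mink q q = - r ^ 2.
  rewrite /q !mink_lin NN nn (minkC nu p) (minkC N p) Nnu endpoint_normal pp -/b -/s; field; lra.
clearbody q.
have cnu t : mink (c t) nu = t * eps by rewrite /c !mink_lin qn nn endpoint_normal; ring.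
have cN t : mink (c t) N = b by rewrite /c !mink_lin qN Nnu NN; ring.
have cc t : mink (c t) (c t) = - r ^ 2.
  rewrite /c !mink_lin qq NN nn (minkC nu q) (minkC N q) qN qn Nnu endpoint_normal.
  transitivity (- r ^ 2 + t ^ 2 * (eps ^ 2 - 1)); [field; lra|rewrite eps2; ring].
have cP t : c t \in P3.
  by apply: memvD; [apply: memvD => //|]; apply: memvZ => //; apply: s23.
have hyp t : hyperbolic_plane r P3 (c t).
  split=> //; split=> //; apply: (mink_lt0_future _ N) => //; rewrite ?cc ?cN; nra.
pose dc t := eps *v nu +v (- / b * t *v N).
have dcE t : is_vderive c t (dc t).
  move=> i; rewrite /c /dc !rvE.
  apply: (is_derive_ext (fun u => q ord0 i + u * (eps * nu ord0 i)
             + (- / (2 * b) * N ord0 i) * u ^ 2)).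
    by move=> u; rewrite !rvE /=; ring.
  by evar_last; [exact: is_derive_quadratic|rewrite /=; field; lra].
have dcnu t : mink (dc t) nu = eps by rewrite /dc !mink_lin nn endpoint_normal; ring.
exists 0, (Rabs s), c; split=> //.
- exact: Rabs_pos.
- move=> i k t _.
  apply: (ex_derive_n_ext (fun u => q ord0 i + u * (eps * nu ord0 i)
             + (- / (2 * b) * N ord0 i) * u ^ 2)).
    by move=> u; rewrite /c !rvE /=; ring.
  exact: ex_derive_n_quadratic.
- move=> t _; split; first by split=> //; rewrite cN.
  rewrite (is_vderive_velocity _ _ _ (dcE t)) => d0.
  by have := dcnu t; rewrite d0 mink0l; nra.
- move=> t t' _ _ /(congr1 (fun X => mink X nu)); rewrite !cnu => h.
  rewrite -(Rmult_1_r t) -(Rmult_1_r t') -eps2; have : (t * eps) * eps = (t' * eps) * eps by rewrite h.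
  by move=> ?; lra.
- split.
  + split; last exact: hyp.
    by apply: normal_orthogonal => //; rewrite cnu; ring.
  + rewrite /c epss pow2_abs -[RHS]qE.
    rewrite (_ : - / (2 * b) * s ^ 2 = - (s ^ 2 / (2 * b))) //; field; lra.
  + rewrite (RInt_ext _ (fun=> 1)); first by rewrite RInt_const Rminus_0_r -[LHS]Rmult_1_r.
    move=> t _; rewrite /speed (is_vderive_velocity _ _ _ (dcE t)) -sqrt_1.
    by congr sqrt; rewrite /dc !mink_lin nn NN Nnu endpoint_normal; lra.
Qed.

Lemma horocycle_distE p : hyperbolic_plane r P3 p ->
  horocycle_dist r P3 (geodesic r P3 P2) N p = Rabs (mink p nu).
Proof.
move=> hp; apply: iota_unique => [d|]; first exact: horocycle_arc_lengthE.
exact: exists_horocycle_arc.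
Qed.

(** The two densities agree on the hyperbolic plane, which contains the varied curves only for [s]
    in []-eps, eps[] and [t] in [[a, b]]. The functionals thus agree near [s = 0], enough for the
    derivative there. *)
Lemma critical_horocycle_dist alpha beta g :
  critical (hyperbolic_plane r P3)
    (horocycle_dist r P3 (geodesic r P3 P2) N) alpha beta g <->
  critical (hyperbolic_plane r P3) (fun p => Rabs (mink p nu)) alpha beta g.
Proof.
have E a b eps G s : a < b -> variation (hyperbolic_plane r P3) g a b eps G ->
    -eps < s < eps ->
    weighted_length (horocycle_dist r P3 (geodesic r P3 P2) N) (G s) a b =
    weighted_length (fun p => Rabs (mink p nu)) (G s) a b.
  move=> ab var sI; apply: RInt_ext; rewrite Rmin_left ?Rmax_right; try lra.
  move=> t tI; rewrite horocycle_distE //; apply: (variation_in var) => //; lra.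
have loc eps (Q : R -> Prop) : 0 < eps -> (forall s, -eps < s < eps -> Q s) -> locally 0 Q.
  move=> e0 h; apply: (locally_interval _ 0 (- eps) eps) => /= [||s ? ?]; try lra.
  by apply: h; lra.
split=> cr a b ab aI bI eps G e0 var.
  apply: is_derive_ext_loc (cr a b ab aI bI eps G e0 var).
  by apply: (loc eps) => // s sI; apply: (E a b eps).
apply: is_derive_ext_loc (cr a b ab aI bI eps G e0 var).
by apply: (loc eps) => // s sI; rewrite (E a b eps).
Qed.

End HorocycleDistance.

(** * Surfaces of revolution *)

Lemma open_itv_locally alpha beta t :
  open_itv alpha beta t -> locally t (open_itv alpha beta).
Proof. by case=> at_ tb; apply: (locally_interval _ t alpha beta). Qed.

Lemma locally_2d_fst (P : R -> Prop) u v :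
  locally u P -> locally_2d (fun x _ => P x) u v.
Proof. by case=> eps Pe; exists eps => x y xu _; apply: Pe. Qed.

Lemma continuity_2d_pt_fst (f : R -> R) u v :
  continuous f u -> continuity_2d_pt (fun x _ => f x) u v.
Proof.
move=> /(continuity_pt_filterlim f) cf.
by apply: continuity_1d_2d_pt_comp => //; apply: continuity_2d_pt_id1.
Qed.

Lemma continuity_2d_pt_snd (f : R -> R) u v :
  continuous f v -> continuity_2d_pt (fun _ y => f y) u v.
Proof.
move=> /(continuity_pt_filterlim f) cf.
by apply: continuity_1d_2d_pt_comp => //; apply: continuity_2d_pt_id2.
Qed.

(** The family is closed under both partial derivatives: in [x] one differentiates [f1] and [f2], in
    [y] one passes from [(a, b, c)] to [(b, - a, 0)] and from [f1] to 0. Coordinates of a surface of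
    revolution belong to it. *)
Lemma ex_diff_n_trig (I : R -> Prop) k (f1 f2 : R -> R) a b c u v :
  (forall u, I u -> locally u I) ->
  (forall n u, I u -> ex_derive_n f1 n u) ->
  (forall n u, I u -> ex_derive_n f2 n u) -> I u ->
  ex_diff_n (fun x y => f1 x + f2 x * (a * cos y + b * sin y + c)) k u v.
Proof.
move=> oI; elim: k f1 f2 a b c u v => [|k IH] f1 f2 a b c u v s1 s2 Iu.
all: have trig y : is_derive (fun y => a * cos y + b * sin y + c) y
    (b * cos y + (- a) * sin y + 0) by auto_derive => //; ring.
all: have cont : continuity_2d_pt
    (fun x y => f1 x + f2 x * (a * cos y + b * sin y + c)) u v.
1,3: apply: continuity_2d_pt_plus; last apply: continuity_2d_pt_mult.
1,2,4,5: by apply: continuity_2d_pt_fst; apply: ex_derive_continuous;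
  [apply: (s1 1%nat) || apply: (s2 1%nat)].
1,2: by apply: (continuity_2d_pt_snd (fun y => a * cos y + b * sin y + c));
  apply: ex_derive_continuous; eexists; apply: trig.
  by [].
have d1 x y : I x -> is_derive (fun x => f1 x + f2 x * (a * cos y + b * sin y + c)) x
    (Derive f1 x + Derive f2 x * (a * cos y + b * sin y + c)).
  move=> Ix; auto_derive; last by rewrite !Rmult_1_l.
  by split; [apply: (s1 1%nat)|split=> //; apply: (s2 1%nat)].
have d2 x y : is_derive (fun y => f1 x + f2 x * (a * cos y + b * sin y + c)) y
    (0 + f2 x * (b * cos y + (- a) * sin y + 0)) by auto_derive => //; ring.
split=> //; split; first by eexists; apply: d1.
split; first by eexists; apply: d2.
split.
  apply: (ex_diff_n_ext_loc (fun x y =>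
    Derive f1 x + Derive f2 x * (a * cos y + b * sin y + c))).
    apply: (locally_2d_impl _ _ _ _ _ (locally_2d_fst _ _ _ (oI u Iu))).
    by apply: locally_2d_forall => x y Ix; rewrite (is_derive_unique _ _ _ (d1 x y Ix)).
  by apply: IH => // n x Ix; apply: ex_derive_n_Derive; [apply: s1|apply: s2].
apply: (ex_diff_n_ext_loc (fun x y => 0 + f2 x * (b * cos y + (- a) * sin y + 0))).
  by apply: locally_2d_forall => x y; rewrite (is_derive_unique _ _ _ (d2 x y)).
by apply: IH => // n x Ix; apply: ex_derive_n_const.
Qed.

Lemma ex_derive_n_mink (I : R -> Prop) (c : R -> 'rV[R]_4) X k t :
  (forall t, I t -> locally t I) -> smooth I c -> I t ->
  ex_derive_n (fun u => mink (c u) X) k t.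
Proof.
move=> oI; elim: k c t => [|k IH] c t sc It //.
apply: (ex_derive_n_step _ (fun u => mink (velocity c u) X)).
  apply: filter_imp (oI t It) => u Iu; apply: is_derive_minkl.
  exact: smooth_velocity_correct sc Iu.
by apply: IH => //; apply: smooth_velocity.
Qed.

Lemma exists_matrix (f : 'rV[R]_4 -> 'rV[R]_4) :
  GRing.linear_for *:%R f -> exists A : 'M[R]_4, forall X, X *m A = f X.
Proof.
move=> lf.
pose lfun := GRing.isLinear.Build R 'rV[R]_4 'rV[R]_4 *:%R f lf.
pose F : {linear 'rV[R]_4 -> 'rV[R]_4} := HB.pack f lfun.
by exists (lin1_mx F) => X; rewrite mul_rV_lin1.
Qed.

Section Rotation.

Variables (nu w : 'rV[R]_4).
Hypothesis (nn : mink nu nu = 1) (ww : mink w w = 1) (nw : mink nu w = 0).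

(** Rotation in the plane of [nu] and [w], the identity on its orthogonal complement. Leaving [c]
    and [s] unrelated makes the composition law a polynomial identity; [c ^ 2 + s ^ 2 = 1] enters
    only for isometry. *)
Definition planar_rotation (c s : R) (X : 'rV[R]_4) : 'rV[R]_4 :=
  X +v (((c - 1) * mink X nu - s * mink X w) *v nu)
    +v (((c - 1) * mink X w + s * mink X nu) *v w).

Lemma planar_rotation_comp c s c' s' X :
  planar_rotation c s (planar_rotation c' s' X) =
  planar_rotation (c * c' - s * s') (s * c' + c * s') X.
Proof.
rewrite /planar_rotation !mink_lin (minkC w nu) nn ww nw.
by apply: rv_ext => i; rewrite !rvE; ring.
Qed.

Lemma planar_rotation_isometry c s X Y : c ^ 2 + s ^ 2 = 1 ->
  mink (planar_rotation c s X) (planar_rotation c s Y) = mink X Y.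
Proof.
move=> cs; rewrite /planar_rotation !mink_lin (minkC w nu) nn ww nw.
rewrite (minkC nu Y) (minkC w Y).
transitivity (mink X Y + (c ^ 2 + s ^ 2 - 1) * (mink X nu * mink Y nu + mink X w * mink Y w)).
  by ring.
by rewrite cs; ring.
Qed.

Lemma exists_rotation (P2 : {vspace 'rV[R]_4}) v :
  (forall X, X \in P2 -> mink X nu = 0 /\ mink X w = 0) ->
  exists A, rotation_about P2 A /\
    forall X, X *m A = planar_rotation (cos v) (sin v) X.
Proof.
move=> P2nw.
have lin c s : GRing.linear_for *:%R (planar_rotation c s).
  move=> a X Y; rewrite /planar_rotation !mink_lin.
  by apply: rv_ext => i; rewrite !rvE; ring.
(* The square of the half-angle rotation has positive determinant. *)
set c := cos (v / 2); set s := sin (v / 2).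
have cs : c ^ 2 + s ^ 2 = 1 by rewrite /c /s -!Rsqr_pow2 Rplus_comm sin2_cos2.
have [A AE] := exists_matrix _ (lin c s).
have [B BE] := exists_matrix _ (lin c (- s)).
have AB : A *m B = 1%:M.
  apply/row_matrixP => i; rewrite rowE mulmxA BE AE planar_rotation_comp.
  have -> : - s * c + c * s = 0 by ring.
  have -> : c * c - - s * s = 1 by rewrite -cs; ring.
  rewrite rowE mulmx1 /planar_rotation; apply: rv_ext => j; rewrite !rvE; ring.
have dA : \det A <> 0.
  move=> d0; have := congr1 determinant AB; rewrite det_mulmx d0 det1 GRing.mul0r => h.
  by apply: R1_neq_R0.
have AAE X : X *m (A *m A) = planar_rotation (cos v) (sin v) X.
  rewrite mulmxA !AE planar_rotation_comp; congr planar_rotation.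
    by rewrite -[v in RHS](_ : v / 2 + v / 2 = v) ?cos_plus //; field.
  by rewrite -[v in RHS](_ : v / 2 + v / 2 = v) ?sin_plus //; field.
exists (A *m A); split=> //; split=> [X Y||X /P2nw[Xn Xw]].
- rewrite !AAE planar_rotation_isometry //.
  by rewrite -!Rsqr_pow2 Rplus_comm sin2_cos2.
- by rewrite det_mulmx; apply: Rsqr_pos_lt dA.
- by rewrite AAE /planar_rotation Xn Xw; apply: rv_ext => j; rewrite !rvE; ring.
Qed.

End Rotation.

Lemma is_vderive_slide c t c' (nu k : 'rV[R]_4) :
  is_vderive c t c' ->
  is_vderive (fun u => c u +v (mink (c u) nu *v k)) t (c' +v (mink c' nu *v k)).
Proof.
move=> dc i; rewrite !rvE.
apply: (is_derive_ext (fun u => c u ord0 i + mink (c u) nu * k ord0 i)).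
  by move=> u; rewrite !rvE.
have := is_derive_minkl _ _ _ nu dc; have := dc i => d1 d2.
apply: is_derive_plus => //.
evar_last; first exact: is_derive_Rmult d2 (is_derive_const (k ord0 i) t).
by rewrite /zero /=; ring.
Qed.

Lemma is_vderive_mink_scale c t c' (nu k : 'rV[R]_4) :
  is_vderive c t c' ->
  is_vderive (fun u => mink (c u) nu *v k) t (mink c' nu *v k).
Proof.
move=> dc i; rewrite !rvE.
apply: (is_derive_ext (fun u => mink (c u) nu * k ord0 i)).
  by move=> u; rewrite !rvE.
have := is_derive_minkl _ _ _ nu dc => d2.
evar_last; first exact: is_derive_Rmult d2 (is_derive_const (k ord0 i) t).
by rewrite /zero /=; ring.
Qed.

(** * Mean curvature of a surface of revolution *)

Section MinimalSurface.

Variables (r : R) (P3 P2 : {vspace 'rV[R]_4}) (N nu : 'rV[R]_4).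
Variables (alpha beta : Rbar) (g : R -> 'rV[R]_4).
Hypothesis (r_gt0 : 0 < r) (conf : plane_and_geodesic r P3 P2).
Hypothesis (endpt : ideal_endpoint P2 N) (nuP : unit_normal_in P3 P2 nu).
Hypothesis (reg : regular_curve r P3 alpha beta g).

Let I := open_itv alpha beta.

Lemma regular_curve_vderive t : I t -> is_vderive g t (velocity g t).
Proof. by case: reg => _ sg _ _; apply: smooth_velocity_correct. Qed.

Lemma regular_curve_vderive2 t :
  I t -> is_vderive (velocity g) t (velocity (velocity g) t).
Proof.
case: reg => _ sg _ _; apply: smooth_velocity_correct; exact: smooth_velocity.
Qed.

(** Differentiating [mink g g = - r ^ 2] makes the velocity orthogonal to the timelike position
    vector, hence spacelike; the speed is then a square root of a positive number. *)
Lemma regular_curve_velocity t : I t ->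
  [/\ velocity g t \in P3, mink (velocity g t) (g t) = 0 &
      0 < mink (velocity g t) (velocity g t)].
Proof.
move=> It; have dg := regular_curve_vderive t It.
case: reg => _ _ gH g0.
have gg0 : mink (velocity g t) (g t) = 0.
  have := is_derive_local_const _ _ _ (- r ^ 2) (is_derive_mink _ _ _ _ _ dg dg).
  rewrite (minkC (g t)) => h.
  suff: mink (velocity g t) (g t) + mink (velocity g t) (g t) = 0 by lra.
  apply: h; apply: filter_imp (open_itv_locally _ _ _ It) => u Iu.
  by have [_ []] := gH u Iu.
split=> //.
  apply: (velocity_mem r P3 P2 conf g t) => //.
  apply: filter_imp (open_itv_locally _ _ _ It) => u Iu; by have [] := gH u Iu.
apply: (timelike_orthogonal (g t)) => //; last exact: g0.
by have [_ [-> _]] := gH t It; nra.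
Qed.

(** The first fundamental form of the orbit patch is diagonal, so the mixed second derivative drops
    out of the mean curvature. At [v = 0] the second derivative in [v] is [- mink (g t) nu *v nu];
    cancelling one factor [mink (g t) nu] in the numerator gives the equation. *)
Lemma minimal_surface_curvature :
  (forall t, I t -> g t \notin P2) ->
  minimal_surface r (surface_of_revolution P2 alpha beta g) ->
  forall t n, I t -> mink n n = 1 -> n \in P3 -> mink (g t) n = 0 ->
  mink (velocity g t) n = 0 ->
  mink (g t) nu * mink (velocity (velocity g) t) n =
  mink nu n * mink (velocity g t) (velocity g t).
Proof.
move=> gP2 minS t n It n1 nP3 gn g'n.
case: (reg) => _ sg gH g0; case: (nuP) => nP nn nP2.
have [w [ww wP]] := exists_ambient_normal r P3 P2 conf.
have nw : mink nu w = 0 by apply/eqP; rewrite -wP.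
have gw u : I u -> mink (g u) w = 0 by move=> /gH[]; rewrite wP => /eqP.
have g'w u : I u -> mink (velocity g u) w = 0.
  by move=> /regular_curve_velocity[]; rewrite wP => /eqP.
have sub : forall X, X \in P2 -> mink X nu = 0 /\ mink X w = 0.
  move=> X XP2; split; first exact: nP2.
  by case: conf => _ _ _ /subvP s23 _; apply/eqP; rewrite -wP; apply: s23.
(* [h v] is the displacement of [nu] under rotation by [v]. As [g u] is orthogonal to [w], only its
   [nu]-component moves, which gives [F] with the variables separated. *)
pose h v := (cos v - 1) *v nu +v (sin v *v w).
pose h' v := - sin v *v nu +v (cos v *v w).
pose h'' v := - cos v *v nu +v (- sin v *v w).
pose F u v := g u +v (mink (g u) nu *v h v).
have dg u : I u -> is_vderive g u (velocity g u) by apply: regular_curve_vderive.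
have dg' := regular_curve_vderive2.
have h0 : h 0 = GRing.zero.
  by rewrite /h cos_0 sin_0; apply: rv_ext => i; rewrite !rvE; ring.
have p1 u v : I u ->
    partial1 F u v = velocity g u +v (mink (velocity g u) nu *v h v).
  by move=> Iu; apply: is_vderive_velocity; apply: is_vderive_slide; apply: dg.
have p2 u v : partial2 F u v = mink (g u) nu *v h' v.
  apply: is_vderive_velocity => i; rewrite /h' !rvE.
  apply: (is_derive_ext (fun v => g u ord0 i + mink (g u) nu *
     ((cos v - 1) * nu ord0 i + sin v * w ord0 i))).
    by move=> x; rewrite /F /h !rvE.
  move: (g u ord0 i) (mink (g u) nu) (nu ord0 i) (w ord0 i) => x y z1 z2.
  by auto_derive => //; ring.
have rot u v : I u -> F u v = planar_rotation nu w (cos v) (sin v) (g u).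
  move=> Iu; rewrite /F /planar_rotation /h gw //.
  by apply: rv_ext => i; rewrite !rvE; ring.
have rot' u v : I u -> partial1 F u v = planar_rotation nu w (cos v) (sin v) (velocity g u).
  move=> Iu; rewrite p1 // /planar_rotation /h g'w //.
  by apply: rv_ext => i; rewrite !rvE; ring.
have trig v : cos v ^ 2 + sin v ^ 2 = 1.
  by rewrite -!Rsqr_pow2 Rplus_comm sin2_cos2.
(* This is where avoiding the axis matters: it makes the patch an immersion and allows the final
   cancellation. *)
have sig u : I u -> mink (g u) nu <> 0.
  move=> Iu gn0; move: (gP2 u Iu); rewrite (normal_orthogonal r P3 P2 nu conf nuP) //.
  by have [] := gH u Iu.
have p11 u v : I u -> mink (partial1 F u v) (partial1 F u v) = mink (velocity g u) (velocity g u).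
  by move=> Iu; rewrite rot' // planar_rotation_isometry.
have p22 u v : mink (partial2 F u v) (partial2 F u v) = mink (g u) nu ^ 2.
  rewrite p2 /h' !mink_lin nn ww (minkC w) nw.
  transitivity (mink (g u) nu ^ 2 * (cos v ^ 2 + sin v ^ 2)); first by ring.
  by rewrite trig; ring.
have p12 u v : I u -> mink (partial1 F u v) (partial2 F u v) = 0.
  move=> Iu; rewrite rot' // p2 /planar_rotation /h' !mink_lin g'w // nn ww (minkC w nu) nw.
  ring.
have patch : regular_patch r (surface_of_revolution P2 alpha beta g) (fun u _ => I u) F.
  split=> [u v Iu|i k u v Iu|u v Iu|u v Iu].
  - by apply: locally_2d_fst; apply: open_itv_locally.
  - apply: (ex_diff_n_ext_loc (fun x y => g x ord0 i + mink (g x) nu *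
       (nu ord0 i * cos y + w ord0 i * sin y + (- nu ord0 i)))).
      by apply: locally_2d_forall => x y; rewrite /F /h !rvE; ring.
    apply: (ex_diff_n_trig I) => // [x Ix|m x Ix|m x Ix].
    + exact: open_itv_locally.
    + exact: sg.
    + apply: (ex_derive_n_mink I) => // y; exact: open_itv_locally.
  - split.
      have FF : mink (F u v) (F u v) = - r ^ 2.
        by rewrite rot // planar_rotation_isometry //; have [_ []] := gH u Iu.
      split=> //; case: (endpt) => NP NN N0; have [Nn Nw] := sub N NP.
      (* [nu] and [w] are orthogonal to [N], so the rotation keeps the product with [N] and with it
         the sheet. *)
      apply: (mink_lt0_future _ N) => //; rewrite ?FF ?NN; try nra.
      rewrite /F /h !mink_lin (minkC nu) Nn (minkC w) Nw.
      have [_ gh] := gH u Iu.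
      have := mink_endpoint_lt0 r P2 r_gt0 N endpt (g u) gh; lra.
    have [A [rotA AE]] := exists_rotation nu w nn ww nw P2 v sub.
    by exists u, A; split=> //; rewrite AE rot.
  - apply: free_orthogonal => [x|]; last by rewrite /= p12 // eqxx.
    have [_ _ g'g'] := regular_curve_velocity u Iu.
    rewrite !inE => /orP[] /eqP ->; rewrite ?p11 ?p22 //; first lra.
    by apply: pow_nonzero; apply: sig.
have norm : patch_normal F t 0 n.
  split=> //; rewrite p1 // p2 /F h0 /h' cos_0 sin_0 !mink_lin gn g'n.
  have nw0 : mink w n = 0 by rewrite minkC; apply/eqP; rewrite -wP.
  by rewrite nw0; split; ring.
have loc := open_itv_locally _ _ _ It.
have p1p1 : partial1 (partial1 F) t 0 = velocity (velocity g) t.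
  transitivity (velocity (velocity g) t +v (mink (velocity (velocity g) t) nu *v h 0)).
    apply: is_vderive_velocity.
    apply: is_vderive_ext_loc (is_vderive_slide _ _ _ nu (h 0) (dg' t It)).
    by apply: filter_imp loc => u Iu; rewrite p1.
  by rewrite h0 GRing.scaler0 GRing.addr0.
have p1p2 : partial1 (partial2 F) t 0 = mink (velocity g t) nu *v h' 0.
  apply: is_vderive_velocity.
  apply: is_vderive_ext_loc (is_vderive_mink_scale _ _ _ nu (h' 0) (dg t It)).
  by apply: filter_forall => u; rewrite p2.
have p2p2 : partial2 (partial2 F) t 0 = mink (g t) nu *v h'' 0.
  apply: is_vderive_velocity => i; rewrite /h'' !rvE.
  apply: (is_derive_ext (fun v => mink (g t) nu *
     (- sin v * nu ord0 i + cos v * w ord0 i))).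
    by move=> x; rewrite p2 /h' !rvE.
  move: (mink (g t) nu) (nu ord0 i) (w ord0 i) => y z1 z2.
  by auto_derive => //; ring.
have := minS _ _ patch t 0 n It norm.
rewrite /mean_curvature p11 // p12 // p22 p1p1 p1p2 p2p2.
have wn : mink w n = 0 by rewrite minkC; apply/eqP; rewrite -wP.
rewrite /h'' cos_0 sin_0 !mink_lin wn.
have [_ _ g'g'] := regular_curve_velocity t It.
have s0 := sig t It.
set S := mink (g t) nu; set Q := mink (velocity g t) (velocity g t).
move=> H.
have den : 2 * (Q * S ^ 2 - 0 ^ 2) <> 0.
  have : 0 < S ^ 2 by apply: pow2_gt_0.
  by rewrite -/Q in g'g' => ?; nra.
move/(Rmult_eq_compat_r (2 * (Q * S ^ 2 - 0 ^ 2))): H.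
rewrite /Rdiv Rmult_assoc Rinv_l // => H.
apply: (Rmult_eq_reg_l S) => //; lra.
Qed.

End MinimalSurface.

(** * First variation *)

Lemma is_derive_sqrt (q : R -> R) t q' :
  is_derive q t q' -> 0 < q t ->
  is_derive (fun u => sqrt (q u)) t (q' / (2 * sqrt (q t))).
Proof.
move=> dq q0; auto_derive; first by split=> //; exists q'.
by rewrite (is_derive_unique _ _ _ dq) Rmult_1_l /Rdiv.
Qed.

(* A one-sided difference quotient suffices, so that [t] may be an endpoint. *)
Lemma is_derive_zero_on (f : R -> R) (a b t l : R) :
  a < b -> a <= t <= b -> (forall u, a <= u <= b -> f u = 0) ->
  is_derive f t l -> l = 0.
Proof.
move=> ab tI f0 /is_derive_Reals df.
case: (Req_dec l 0) => // l0.
have l1 : 0 < Rabs l / 2 by have := Rabs_pos_lt l l0; lra.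
have [[d d0] /= D] := df _ l1.
have [h [h0 hd hI]] : exists h, [/\ h <> 0, Rabs h < d & a <= t + h <= b].
  case: (Rlt_le_dec t b) => tb.
    exists (Rmin (d / 2) (b - t)).
    have := Rmin_l (d / 2) (b - t); have := Rmin_r (d / 2) (b - t).
    have m0 : 0 < Rmin (d / 2) (b - t) by apply: Rmin_glb_lt; lra.
    by rewrite Rabs_pos_eq; [split|]; lra.
  exists (- Rmin (d / 2) (b - a)).
  have := Rmin_l (d / 2) (b - a); have := Rmin_r (d / 2) (b - a).
  have m0 : 0 < Rmin (d / 2) (b - a) by apply: Rmin_glb_lt; lra.
  by rewrite Rabs_Ropp Rabs_pos_eq; [split|]; lra.
have := D h h0 hd; rewrite !f0 // Rminus_diag /Rdiv Rmult_0_l Rminus_0_l Rabs_Ropp.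
lra.
Qed.

(** A variation restricts to [g] on [[a, b]] only, yet the velocities must also agree at [a] and
    [b]. *)
Lemma is_vderive_agree c d (a b t : R) v w :
  a < b -> a <= t <= b -> (forall u, a <= u <= b -> c u = d u) ->
  is_vderive c t v -> is_vderive d t w -> v = w.
Proof.
move=> ab tI cd cv dw; apply: rv_ext => i.
have := is_derive_minus _ _ _ _ _ (cv i) (dw i) => dm.
have := is_derive_zero_on _ a b t _ ab tI _ dm.
rewrite /minus /plus /opp /= => h; apply: Rminus_diag_uniq; apply: h => u uI.
by rewrite cd //; ring.
Qed.

Lemma continuity_2d_pt_section (f : R -> R -> R) s t :
  continuity_2d_pt f s t -> continuous (f s) t.
Proof.
move=> cf; apply/continuity_pt_filterlim/continuity_pt_locally => eps.
have [d dP] := cf eps; exists d => y yt; apply: dP => //.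
by rewrite Rminus_diag Rabs_R0; apply: cond_pos.
Qed.

Lemma locally_2d_positive (f : R -> R -> R) s t :
  continuity_2d_pt f s t -> 0 < f s t -> locally_2d (fun x y => 0 < f x y) s t.
Proof.
move=> cf f0; have [d dP] := cf (mkposreal _ f0); exists d => x y xs yt.
by have /= := dP x y xs yt => /Rabs_def2; lra.
Qed.

(** The minimum over the compact interval is positive, and uniform continuity near the slice makes
    the deviation smaller than it. Applied to the product with [nu] and to the squared speed. *)
Lemma positive_tube (f : R -> R -> R) (s a b : R) :
  a <= b -> (forall t, a <= t <= b -> continuity_2d_pt f s t) ->
  (forall t, a <= t <= b -> 0 < f s t) ->
  locally s (fun x => forall t, a <= t <= b -> 0 < f x t).
Proof.
move=> ab cf f0.
have [m [mP mI]] : exists m, (forall t, a <= t <= b -> f s m <= f s t) /\ a <= m <= b.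
  apply: continuity_ab_min => // t /cf /continuity_2d_pt_section.
  by move/continuity_pt_filterlim.
have [d dP] := uniform_continuity_2d_1d' f a b s cf (mkposreal _ (f0 m mI)).
exists d => x xs t tI; have d0 := cond_pos d.
have xs' : Rabs (x - s) < d by [].
have [xs1 xs2] := Rabs_def2 _ _ xs'.
have /= := dP t s t x tI _ tI _ _; rewrite Rminus_diag Rabs_R0 => h.
have := h ltac:(lra) ltac:(lra) d0 => /Rabs_def2; have := mP t tI; lra.
Qed.

(** * Smooth two-parameter families of vectors *)

Definition vcontinuous_2d (F : R -> R -> 'rV[R]_4) s t :=
  forall i, continuity_2d_pt (fun x y => F x y ord0 i) s t.

Lemma continuity_2d_pt_mink F H s t :
  vcontinuous_2d F s t -> vcontinuous_2d H s t ->
  continuity_2d_pt (fun x y => mink (F x y) (H x y)) s t.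
Proof.
move=> cF cH; apply: (continuity_2d_pt_ext _ _ _ _ (fun x y => esym (minkE (F x y) (H x y)))).
do ?[apply: continuity_2d_pt_plus]; first apply: continuity_2d_pt_opp.
all: exact: continuity_2d_pt_mult.
Qed.

Lemma vcontinuous_2d_const X s t : vcontinuous_2d (fun _ _ => X) s t.
Proof. move=> i; exact: continuity_2d_pt_const. Qed.

Section Smooth2.

Variables (D : R -> R -> Prop) (F : R -> R -> 'rV[R]_4).
Hypothesis sF : smooth2 D F.

Lemma smooth2_partial1 : smooth2 D (partial1 F).
Proof.
move=> i k u v Duv; have [_ [_ [_ [d1 _]]]] := sF i k.+1 u v Duv.
apply: ex_diff_n_ext_loc d1; apply: locally_2d_forall => x y.
by rewrite /partial1 velocityE.
Qed.

Lemma smooth2_partial2 : smooth2 D (partial2 F).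
Proof.
move=> i k u v Duv; have [_ [_ [_ [_ d2]]]] := sF i k.+1 u v Duv.
apply: ex_diff_n_ext_loc d2; apply: locally_2d_forall => x y.
by rewrite /partial2 velocityE.
Qed.

Lemma smooth2_vderive1 u v : D u v -> is_vderive (fun x => F x v) u (partial1 F u v).
Proof.
move=> Duv i; have [_ [d1 _]] := sF i 1%nat u v Duv.
by rewrite /partial1 velocityE; apply: Derive_correct.
Qed.

Lemma smooth2_vderive2 u v : D u v -> is_vderive (F u) v (partial2 F u v).
Proof.
move=> Duv i; have [_ [_ [d2 _]]] := sF i 1%nat u v Duv.
by rewrite /partial2 velocityE; apply: Derive_correct.
Qed.

Lemma smooth2_continuous u v : D u v -> vcontinuous_2d F u v.
Proof. by move=> Duv i; have [] := sF i 0%nat u v Duv. Qed.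

End Smooth2.

(** Order two of [ex_diff_n] contains the mixed partials and their continuity. The exchange turns
    the [s]-derivative of the curve velocity into the velocity of the variation field. *)
Lemma smooth2_Schwarz D F u v :
  (forall u v, D u v -> locally_2d D u v) -> smooth2 D F -> D u v ->
  partial1 (partial2 F) u v = partial2 (partial1 F) u v.
Proof.
move=> oD sF Duv; apply: rv_ext => i; rewrite /partial1 /partial2 !velocityE.
have e1 x y : velocity (F x) y ord0 i = Derive (fun z => F x z ord0 i) y by rewrite velocityE.
have e2 x y : velocity (fun z => F z y) x ord0 i = Derive (fun z => F z y ord0 i) x.
  by rewrite velocityE.
rewrite (Derive_ext _ _ _ (fun x => e1 x v)) (Derive_ext _ _ _ (fun y => e2 u y)).
apply: (Schwarz (fun x y => F x y ord0 i)).
- apply: (locally_2d_impl _ _ _ _ _ (oD u v Duv)); apply: locally_2d_forall => x y Dxy.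
  have [_ [d1 [d2 [[_ [_ [d12 _]]] [_ [d21 _]]]]]] := sF i 2%nat x y Dxy.
  by [].
- have [_ [_ [_ [_ [_ [_ [_ [d _]]]]]]]] := sF i 2%nat u v Duv.
  by have [] := d.
- have [_ [_ [_ [[_ [_ [_ [_ d]]]] _]]]] := sF i 2%nat u v Duv.
  by have [] := d.
Qed.

(* Expand [V] in the orthogonal frame formed by [x'] and the normal [n]: along
   [x'] the two sides agree identically, along [n] this is the hypothesis. *)
Lemma first_variation_identity (P : {vspace 'rV[R]_4}) (x x' x'' V nu : 'rV[R]_4) :
  \dim P = 3%nat -> x \in P -> mink x x < 0 -> x' \in P -> mink x' x = 0 ->
  0 < mink x' x' -> V \in P -> mink V x = 0 ->
  (forall n, n \in P -> mink n n = 1 -> mink x n = 0 -> mink x' n = 0 ->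
    mink x nu * mink x'' n = mink nu n * mink x' x') ->
  mink x' x' ^ 2 * mink V nu =
  mink x' nu * mink x' x' * mink V x' + mink x nu * mink x' x' * mink V x''
  - mink x nu * mink V x' * mink x' x''.
Proof.
move=> dP xP xx x'P x'x x'x' VP Vx H.
have [|n0 [n0P n00] n0s] := exists_orthogonal P [:: x; x']; first by rewrite dP.
have n0x : mink n0 x = 0 by apply: n0s; rewrite !inE eqxx.
have n0x' : mink n0 x' = 0 by apply: n0s; rewrite !inE eqxx orbT.
have n0n0 := timelike_orthogonal x n0 xx n0x n00.
pose n := / sqrt (mink n0 n0) *v n0.
have nn : mink n n = 1 by exact: unit_multiple.
have nP : n \in P by apply: memvZ.
have nx : mink n x = 0 by rewrite /n minkZl n0x; ring.
have nx' : mink n x' = 0 by rewrite /n minkZl n0x'; ring.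
have Hn := H n nP nn ltac:(by rewrite minkC) ltac:(by rewrite minkC).
clearbody n.
have VE : V -v ((mink V x' / mink x' x') *v x' +v (mink V n *v n)) = GRing.zero.
  apply: (orthogonal_complete P x [:: x'; n]) => //.
  - by move=> y; rewrite !inE => /or3P[] /eqP ->.
  - move=> y; rewrite !inE => /orP[] /eqP ->; split=> // z.
      by move: x'x'; rewrite z mink0l; lra.
    by move: nn; rewrite z mink0l; lra.
  - by rewrite /= (minkC x') nx' eqxx.
  - by apply: memvB => //; apply: memvD; apply: memvZ.
  - move=> y; rewrite !inE => /or3P[] /eqP ->; rewrite !mink_lin.
    + by rewrite Vx x'x nx; ring.
    + by rewrite nx'; field; lra.
    + by rewrite (minkC x') nx' nn; ring.
move/GRing.subr0_eq: VE => VE.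
rewrite [in X in X = _]VE [in X in _ = _ + X - _]VE !mink_lin (minkC n x'') (minkC n nu).
have -> : mink x' x'' = mink x'' x' by rewrite minkC.
have -> : mink x' nu = mink nu x' by rewrite minkC.
set Q := mink x' x'; set S := mink x nu.
have Hn' : S * mink x'' n = mink nu n * Q by [].
transitivity (Q * mink V x' * mink nu x' + mink V n * (mink nu n * Q) * Q).
  by field; rewrite /Q; lra.
rewrite -Hn'; field; rewrite /Q; lra.
Qed.

(** * From the curvature equation to criticality *)

Section FirstVariation.

Variables (r : R) (P3 P2 : {vspace 'rV[R]_4}) (nu : 'rV[R]_4).
Variables (alpha beta : Rbar) (g : R -> 'rV[R]_4).
Hypothesis (r_gt0 : 0 < r) (conf : plane_and_geodesic r P3 P2).
Hypothesis (reg : regular_curve r P3 alpha beta g).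
Hypothesis side : forall t, open_itv alpha beta t -> 0 < mink (g t) nu.
Hypothesis curvature : forall t n, open_itv alpha beta t ->
  mink n n = 1 -> n \in P3 -> mink (g t) n = 0 -> mink (velocity g t) n = 0 ->
  mink (g t) nu * mink (velocity (velocity g) t) n =
  mink nu n * mink (velocity g t) (velocity g t).

Lemma critical_of_curvature :
  critical (hyperbolic_plane r P3) (fun p => Rabs (mink p nu)) alpha beta g.
Proof.
move=> a b ab aI bI eps G eps0 [[delta [delta0 sG]] GM G0 Ga Gb].
set D := fun s t => _ in sG.
have oD u v : D u v -> locally_2d D u v.
  move=> [uI vI].
  have lu : locally u (fun u => - eps < u < eps).
    by apply: (locally_interval _ u (- eps) eps) => /= [||y ? ?]; lra.
  have lv : locally v (fun v => a - delta < v < b + delta).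
    by apply: (locally_interval _ v (a - delta) (b + delta)) => /= [||y ? ?]; lra.
  case: lu lv => [d1 d1P] [d2 d2P].
  have d0 : 0 < Rmin d1 d2 by apply: Rmin_glb_lt; apply: cond_pos.
  exists (mkposreal _ d0) => x y /= xu yv; split.
    by apply: d1P; apply: Rlt_le_trans xu _; apply: Rmin_l.
  by apply: d2P; apply: Rlt_le_trans yv _; apply: Rmin_r.
have D0 t : a <= t <= b -> D 0 t by move=> tI; split; lra.
have itv t : a <= t <= b -> open_itv alpha beta t.
  move=> tI; case: aI bI => al _ [_ be]; split.
    by apply: Rbar_lt_le_trans al _ => /=; lra.
  by apply: Rbar_le_lt_trans be => /=; lra.
have leps : locally 0 (fun s => - eps < s < eps).
  by apply: (locally_interval _ 0 (- eps) eps) => /= [||y ? ?]; lra.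
have sG1 := smooth2_partial1 _ _ sG; have sG2 := smooth2_partial2 _ _ sG.
have sG12 := smooth2_partial1 _ _ sG2.
have cG := smooth2_continuous _ _ sG; have cG1 := smooth2_continuous _ _ sG1.
have cG2 := smooth2_continuous _ _ sG2; have cG12 := smooth2_continuous _ _ sG12.
have dG1 := smooth2_vderive1 _ _ sG; have dG2 := smooth2_vderive2 _ _ sG.
have dG12 := smooth2_vderive1 _ _ sG2; have dG21 := smooth2_vderive2 _ _ sG1.
have G20 t : a <= t <= b -> partial2 G 0 t = velocity g t.
  move=> tI; apply: (is_vderive_agree (G 0) g a b t) => //; first exact: dG2 (D0 t tI).
  exact: regular_curve_vderive reg t (itv t tI).
pose z s t := mink (G s t) nu.
pose Q s t := mink (partial2 G s t) (partial2 G s t).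
pose h s t := z s t * sqrt (Q s t).
pose dh s t := mink (partial1 G s t) nu * sqrt (Q s t)
  + z s t * (mink (partial1 (partial2 G) s t) (partial2 G s t) / sqrt (Q s t)).
have cz s t : D s t -> continuity_2d_pt z s t.
  by move=> Dst; apply: continuity_2d_pt_mink; [exact: cG|exact: vcontinuous_2d_const].
have cQ s t : D s t -> continuity_2d_pt Q s t.
  by move=> Dst; apply: continuity_2d_pt_mink; exact: cG2.
have csQ s t : D s t -> continuity_2d_pt (fun s t => sqrt (Q s t)) s t.
  move=> Dst; apply: continuity_1d_2d_pt_comp; last exact: cQ.
  apply/continuity_pt_filterlim; exact: continuous_sqrt.
have ch s t : D s t -> continuity_2d_pt h s t.
  by move=> Dst; apply: continuity_2d_pt_mult; [exact: cz|exact: csQ].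
have cdh s t : D s t -> 0 < Q s t -> continuity_2d_pt dh s t.
  move=> Dst Qp; apply: continuity_2d_pt_plus; apply: continuity_2d_pt_mult.
  - by apply: continuity_2d_pt_mink; [exact: cG1|exact: vcontinuous_2d_const].
  - exact: csQ.
  - exact: cz.
  - apply: continuity_2d_pt_mult; first by apply: continuity_2d_pt_mink; [exact: cG12|exact: cG2].
    apply: continuity_2d_pt_inv; first exact: csQ.
    by apply: Rgt_not_eq; apply: sqrt_lt_R0.
have dhE s t : D s t -> 0 < Q s t -> is_derive (fun x => h x t) s (dh s t).
  move=> Dst Qp.
  have d1 := is_derive_minkl _ _ _ nu (dG1 s t Dst).
  have d2 := is_derive_sqrt _ _ _ (is_derive_mink _ _ _ _ _ (dG12 s t Dst) (dG12 s t Dst)) Qp.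
  evar_last; first exact: is_derive_Rmult d1 d2.
  have sQ := sqrt_lt_R0 _ Qp; rewrite /dh (minkC (partial2 G s t)) -/(Q s t) -/(z s t).
  by field; lra.
have z0 t : a <= t <= b -> 0 < z 0 t by move=> tI; rewrite /z G0 //; apply: side; apply: itv.
have Q0 t : a <= t <= b -> 0 < Q 0 t.
  move=> tI; rewrite /Q G20 //.
  by have [] := regular_curve_velocity r P3 P2 alpha beta g r_gt0 conf reg t (itv t tI).
have ltz := positive_tube z 0 a b (Rlt_le _ _ ab) (fun t tI => cz 0 t (D0 t tI)) z0.
have ltQ := positive_tube Q 0 a b (Rlt_le _ _ ab) (fun t tI => cQ 0 t (D0 t tI)) Q0.
have abE : Rmin a b = a /\ Rmax a b = b by rewrite Rmin_left ?Rmax_right //; lra.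
apply: (is_derive_ext_loc (fun s => RInt (h s) a b)).
  apply: filter_imp ltz => s zs; apply: RInt_ext; rewrite abE.1 abE.2 => t tI.
  by rewrite Rabs_pos_eq //; apply: Rlt_le; apply: zs; lra.
have DI s t : - eps < s < eps -> a <= t <= b -> D s t by move=> sI tI; split=> //; lra.
(* Differentiation under the integral needs one neighbourhood of [s = 0] that serves all [t] in
   [[a, b]]; [ltQ] provides it. *)
have dRInt := is_derive_RInt_param h a b 0.
rewrite abE.1 abE.2 in dRInt.
evar_last; first apply: dRInt.
- apply: filter_imp (filter_and _ _ leps ltQ) => s [sI Qs] t tI.
  by eexists; apply: dhE; [apply: DI|apply: Qs].
- move=> t tI; apply: (continuity_2d_pt_ext_loc dh); last by apply: cdh; [apply: D0|apply: Q0].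
  have lQ := locally_2d_positive _ _ _ (cQ 0 t (D0 t tI)) (Q0 t tI).
  apply: (locally_2d_impl _ _ _ _ _ (locally_2d_and _ _ _ _ lQ (oD _ _ (D0 t tI)))).
  by apply: locally_2d_forall => x y [Qp Dxy]; rewrite (is_derive_unique _ _ _ (dhE x y Dxy Qp)).
- apply: filter_imp leps => s sI; apply: ex_RInt_continuous; rewrite abE.1 abE.2 => t tI.
  by apply: continuity_2d_pt_section; apply: ch; apply: DI.
pose V t := partial1 G 0 t.
pose W t := mink (g t) nu * mink (V t) (velocity g t) / sqrt (mink (velocity g t) (velocity g t)).
have endV c : a <= c <= b -> (forall s, - eps < s < eps -> G s c = g c) -> V c = GRing.zero.
  move=> cI Gc; apply: is_vderive_velocity.
  apply: is_vderive_ext_loc (is_vderive_const (g c) 0).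
  by apply: filter_imp leps => s /Gc.
have Va := endV a ltac:(lra) Ga; have Vb := endV b ltac:(lra) Gb.
have Wa : W a = 0 by rewrite /W Va mink0l /Rdiv; ring.
have Wb : W b = 0 by rewrite /W Vb mink0l /Rdiv; ring.
have dW t : a <= t <= b -> is_derive W t (dh 0 t).
  move=> tI; have It := itv t tI; have D0t := D0 t tI.
  have dg := regular_curve_vderive r P3 alpha beta g reg t It.
  have dg' := regular_curve_vderive2 r P3 alpha beta g reg t It.
  have [g'P g'g g'g'] := regular_curve_velocity r P3 P2 alpha beta g r_gt0 conf reg t It.
  have [gP [gg _]] : hyperbolic_plane r P3 (g t) by case: reg => _ _ gH _; apply: gH.
  have dV := dG21 0 t D0t.
  have d1 := is_derive_Rmult _ _ _ _ _ (is_derive_minkl _ _ _ nu dg)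
    (is_derive_mink _ _ _ _ _ dV dg').
  have dQ := is_derive_sqrt _ _ _ (is_derive_mink _ _ _ _ _ dg' dg') g'g'.
  have sQ := sqrt_lt_R0 _ g'g'.
  have d2 := is_derive_div _ _ _ _ _ d1 dQ (Rgt_not_eq _ _ sQ).
  evar_last; first exact: d2.
  have VP : V t \in P3.
    apply: (velocity_mem r P3 P2 conf (fun s => G s t) 0 (V t) (dG1 0 t D0t)).
    by apply: filter_imp leps => s sI; have [] := GM s t sI tI.
  have Vg : mink (V t) (g t) = 0.
    have := is_derive_local_const _ _ _ (- r ^ 2)
      (is_derive_mink _ _ _ _ _ (dG1 0 t D0t) (dG1 0 t D0t)).
    rewrite G0 // (minkC (g t)) => Vg.
    suff: mink (V t) (g t) + mink (V t) (g t) = 0 by lra.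
    by apply: Vg; apply: filter_imp leps => s sI; have [_ []] := GM s t sI tI.
  have id := first_variation_identity P3 (g t) (velocity g t) (velocity (velocity g) t) (V t) nu.
  have {}id := id ltac:(by case: conf) gP ltac:(rewrite gg; nra) g'P g'g g'g' VP Vg
    (fun n nP nn => curvature t n It nn nP).
  rewrite /dh /z /Q (smooth2_Schwarz D) // G0 // G20 // -/(V t).
  move: id sQ g'g'; rewrite (minkC (velocity (velocity g) t) (velocity g t)).
  set B := mink (partial2 (partial1 G) 0 t) (velocity g t).
  set q := mink (velocity g t) (velocity g t).
  move=> id sQ q0; have := sqrt_sqrt q (Rlt_le _ _ q0).
  move: (sqrt q) sQ id => p p0 id qE; rewrite -qE in id.
  (* With the speed abstracted as [p], the factor [p ^ 3] clears all denominators. The terms in [B]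
     are equal on both sides, and what remains is [id]. *)
  apply: (Rmult_eq_reg_l (p ^ 3)); last by apply: pow_nonzero; lra.
  transitivity ((p * p) ^ 2 * mink (V t) nu + mink (g t) nu * B * p ^ 2); last by field; lra.
  by rewrite id; field; lra.
rewrite (RInt_ext _ (fun t => dh 0 t)); last first.
  rewrite abE.1 abE.2 => t tI; apply: is_derive_unique; apply: dhE.
    by apply: D0; lra.
  by apply: Q0; lra.
apply: is_RInt_unique.
have W0 : minus (W b) (W a) = 0 by rewrite Wa Wb; apply: Rminus_diag.
evar_last; last exact: W0.
apply: is_RInt_derive; rewrite abE.1 abE.2 => t tI; first exact: dW.
by apply: continuity_2d_pt_section; apply: cdh; [apply: D0|apply: Q0].
Qed.

End FirstVariation.

Theorem theorem2 (r : R) (r_gt0 : 0 < r) :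
  (forall (P3 P2 : {vspace 'rV[R]_4}) (N : 'rV[R]_4) (alpha beta : Rbar)
      (g : R -> 'rV[R]_4),
    plane_and_geodesic r P3 P2 -> ideal_endpoint P2 N ->
    horo_catenary r P3 P2 N alpha beta g ->
    elliptic_catenary r P3 P2 alpha beta g)
  /\
  (forall (P3 P2 : {vspace 'rV[R]_4}) (alpha beta : Rbar)
      (g : R -> 'rV[R]_4),
    plane_and_geodesic r P3 P2 ->
    regular_curve r P3 alpha beta g ->
    (forall t, open_itv alpha beta t -> g t \notin P2) ->
    minimal_surface r (surface_of_revolution P2 alpha beta g) ->
    forall N : 'rV[R]_4, ideal_endpoint P2 N ->
      horo_catenary r P3 P2 N alpha beta g).
Proof.
split=> [P3 P2 N alpha beta g conf endpt [reg [nu [nuP side]] gl crit]|].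
  split=> // [t It|].
    apply/negP => gP2; apply: (gl t It); split=> //.
    by case: reg => _ _ gH _; apply: gH.
  exists nu; split=> //.
  by apply/(critical_horocycle_dist r P3 P2 N nu r_gt0 conf endpt nuP).
move=> P3 P2 alpha beta g conf reg gP2 minS N endpt.
have [nu0 nu0P] := exists_unit_normal r P3 P2 conf.
have [ab sg gH _] := reg.
have cont t : open_itv alpha beta t -> continuous (fun u => mink (g u) nu0) t.
  move=> It; apply: ex_derive_continuous; eexists; apply: is_derive_minkl.
  exact: smooth_velocity_correct sg It.
have nz t : open_itv alpha beta t -> mink (g t) nu0 <> 0.
  move=> It gn; move: (gP2 t It); rewrite (normal_orthogonal r P3 P2 nu0 conf nu0P) //.
  by case: (gH t It).
(* Avoiding [P2] gives only a nonzero product with [nu0]; on an interval of parameters its sign is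
   constant, so the curve stays on one side. *)
have same s t : open_itv alpha beta s -> open_itv alpha beta t ->
    0 < mink (g s) nu0 * mink (g t) nu0.
  have le x y : x <= y -> open_itv alpha beta x -> open_itv alpha beta y ->
      0 < mink (g x) nu0 * mink (g y) nu0.
    move=> xy [ax _] [_ yb].
    have itv z : x <= z <= y -> open_itv alpha beta z.
      move=> [xz zy]; split; first by apply: Rbar_lt_le_trans ax _.
      by apply: Rbar_le_lt_trans yb.
    apply: (nonvanishing_same_sign (fun u => mink (g u) nu0)) => // z /itv.
      exact: cont.
    exact: nz.
  move=> Is It; case: (Rle_lt_dec s t) => st; first exact: le.
  by rewrite Rmult_comm; apply: le => //; lra.
have [nu [nuP side]] : on_one_side P3 P2 alpha beta g.
  have [m Im] : exists m, open_itv alpha beta m.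
    case: (alpha) (beta) ab => [x||] [y||] //= xy.
    - exists ((x + y) / 2); split=> /=; lra.
    - exists (x + 1); split=> //=; lra.
    - exists (y - 1); split=> //=; lra.
    - by exists 0.
  (* The sign at the sample parameter [m] decides between [nu0] and its opposite. *)
  case: (Rlt_le_dec 0 (mink (g m) nu0)) => m0.
    by exists nu0; split=> // t It; have := same m t Im It; nra.
  exists (GRing.opp nu0); case: (nu0P) => nP nn n2; split.
    split; first by rewrite memvN.
      by rewrite !mink_lin nn; ring.
    by move=> X XP; rewrite minkNr n2 //; ring.
  by move=> t It; rewrite minkNr; have := same m t Im It; nra.
split=> // [|t It [gt _]|].
- by exists nu.
- by move: (gP2 t It); rewrite gt.
- apply/(critical_horocycle_dist r P3 P2 N nu r_gt0 conf endpt nuP).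
  apply: (critical_of_curvature r P3 P2) => // t n It nn nP gn g'n.
  exact: (minimal_surface_curvature r P3 P2 N nu alpha beta g).
Qed.
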